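(* Let $a>b>0$, let $\mathcal{E}:\ \frac{\mathsf{x}^2}{a}+\frac{\mathsf{y}^2}{b}=1$, and let $\mathcal{C}_{\lambda_0}$, $\lambda_0\in(0,b)\cup(b,a)$, be a conic confocal with $\mathcal{E}$. Let $n\ge2$ be an integer. The billiard trajectories within $\mathcal{E}$ with caustic $\mathcal{C}_{\lambda_0}$ are $n$-elliptic periodic without being $n$-periodic if and only if there exists a pair of real polynomials $p_{d_1}$, $q_{d_2}$ of degrees $d_1$, $d_2$ respectively, satisfying one of the following: (a) $\mathcal{C}_{\lambda_0}$ is an ellipse and - $n=2m$ is even, $d_1=d_2=m-1$, and $$s\left(s-\frac1{\lambda_0}\right)p_{m-1}^2(s)-\left(s-\frac1a\right)\left(s-\frac1b\right)q_{m-1}^2(s)=-1;$$ - or $n=2m+1$ is odd, $d_1=m$, $d_2=m-1$, and $$s\,p_m^2(s)-\left(s-\frac1a\right)\left(s-\frac1b\right)\left(s-\frac1{\lambda_0}\right)q_{m-1}^2(s)=1;$$ (b) $\mathcal{C}_{\lambda_0}$ is a hyperbola and - $n=2m$ is even, $d_1=d_2=m-1$, and $$s\left(s-\frac1b\right)p_{m-1}^2(s)-\left(s-\frac1a\right)\left(s-\frac1{\lambda_0}\right)q_{m-1}^2(s)=-1;$$ - or $n=2m+1$ is odd, $d_1=m$, $d_2=m-1$, and $$s\,p_m^2(s)-\left(s-\frac1a\right)\left(s-\frac1b\right)\left(s-\frac1{\lambda_0}\right)q_{m-1}^2(s)=1;$$ (c) $\mathcal{C}_{\lambda_0}$ is a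 hyperbola, $n=2m+1$ is odd, $d_1=m$, $d_2=m-1$, and $$\left(s-\frac1b\right)p_m^2(s)-s\left(s-\frac1a\right)\left(s-\frac1{\lambda_0}\right)q_{m-1}^2(s)=-1.$$
   Context: The confocal family is $\mathcal{C}_{\lambda}:\ \frac{\mathsf{x}^2}{a-\lambda}+\frac{\mathsf{y}^2}{b-\lambda}=1$; $\mathcal{C}_\lambda$ is an ellipse for $\lambda<b$, a hyperbola for $\lambda\in(b,a)$, with degenerate members the $\mathsf{x}$-axis ($\lambda=b$) and the $\mathsf{y}$-axis ($\lambda=a$). Billiard trajectories within $\mathcal{E}$ are polygonal lines with vertices on $\mathcal{E}$ obeying the reflection law at each vertex; a trajectory has caustic $\mathcal{C}_{\lambda_0}$ if all lines containing its segments are tangent to $\mathcal{C}_{\lambda_0}$. A trajectory is $n$-periodic if it closes after $n$ reflections ($n$ not required to be minimal). Every point other than the foci lies on exactly two conics $\mathcal{C}_{\lambda_1},\mathcal{C}_{\lambda_2}$, $\lambda_1<\lambda_2$; $(\lambda_1,\lambda_2)$ are its elliptic coordinates. A trajectory is $n$-elliptic periodic if it is $n$-periodic in elliptic coordinates, i.e. the elliptic coordinates of the moving point along the trajectory repeat periodically after $n$ reflections. *)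

(* Defs.v *)
From mathcomp Require Import all_boot all_order all_algebra.
From mathcomp Require Import reals.

Set Implicit Arguments.
Unset Strict Implicit.
Unset Printing Implicit Defensive.

Import Order.TTheory GRing.Theory Num.Theory.
Local Open Scope ring_scope.

Section EllipticBilliard.
Variable R : realType.
Implicit Types (a b lam t : R) (A B V N : R * R) (P : nat -> R * R).

(* The member C_lam of the confocal family; the degenerate members are the
   x-axis for lam = b and the y-axis for lam = a. *)
Definition on_conic a b lam A : Prop :=
  if lam == a then A.1 = 0
  else if lam == b then A.2 = 0
  else A.1 ^+ 2 / (a - lam) + A.2 ^+ 2 / (b - lam) = 1.

Definition conic_is_ellipse b lam : Prop := lam < b.
Definition conic_is_hyperbola a b lam : Prop := b < lam /\ lam < a.

Definition elliptic_coordinates a b A (l1 l2 : R) : Prop :=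
  [/\ l1 < l2, on_conic a b l1 A & on_conic a b l2 A].

(* The foci have no elliptic coordinates, so this fails at the foci. *)
Definition same_elliptic_coordinates a b A B : Prop :=
  exists l1 l2, elliptic_coordinates a b A l1 l2 /\
                elliptic_coordinates a b B l1 l2.

(* For A <> B and C_lam nondegenerate: the line AB is tangent to C_lam at the
   point [X : Y : Z] of its projective closure. Points at infinity (Z = 0) are
   allowed, so the asymptotes of a hyperbola count as tangent lines. *)
Definition line_tangent a b lam A B : Prop :=
  exists X Y Z : R,
    [/\ (X, Y, Z) <> (0, 0, 0),
        X ^+ 2 / (a - lam) + Y ^+ 2 / (b - lam) = Z ^+ 2,
        A.1 * X / (a - lam) + A.2 * Y / (b - lam) = Z &
        B.1 * X / (a - lam) + B.2 * Y / (b - lam) = Z].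

Definition dot A B : R := A.1 * B.1 + A.2 * B.2.

(* Reflection of the direction V in the line orthogonal to N. *)
Definition reflect_dir N V : R * R :=
  let c := 2 * dot V N / dot N N in (V.1 - c * N.1, V.2 - c * N.2).

(* A normal vector to the boundary ellipse x^2/a + y^2/b = 1 at A. *)
Definition normal_at a b A : R * R := (A.1 / a, A.2 / b).

(* P lists the successive vertices; the boundary ellipse is C_0. At each vertex
   the outgoing direction is a positive multiple of the reflection of the
   incoming direction in the tangent line of the boundary. *)
Definition billiard_trajectory a b P : Prop :=
  [/\ forall k, on_conic a b 0 (P k),
      forall k, P k.+1 <> P k &
      forall k,
        let V := reflect_dir (normal_at a b (P k.+1)) (P k.+1 - P k) in
        exists2 c : R, 0 < c & P k.+2 - P k.+1 = (c * V.1, c * V.2)].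

Definition has_caustic a b lam P : Prop :=
  forall k, line_tangent a b lam (P k) (P k.+1).

Definition periodic (n : nat) P : Prop := forall k, P (k + n)%N = P k.

(* The moving point on the k-th segment, at t in [0, 1]. *)
Definition moving_point P (k : nat) t : R * R :=
  ((1 - t) * (P k).1 + t * (P k.+1).1, (1 - t) * (P k).2 + t * (P k.+1).2).

Definition elliptic_periodic a b (n : nat) P : Prop :=
  forall k t, 0 <= t <= 1 ->
    same_elliptic_coordinates a b (moving_point P (k + n) t)
                                  (moving_point P k t).

(* The zero polynomial has no degree. *)
Definition has_degree (p : {poly R}) (d : nat) : Prop := size p = d.+1.

End EllipticBilliard.

(* Main.v *)
(* The billiard has a Lax pair. Let (p, v) be the state of the ball (p a vertex, v
   the unit outgoing velocity) and put s = 1/lambda. The matrix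
     L(s) = [[ q(p,v), 1 - q(p,p) ], [ q(v,v), - q(p,v) ]],
   q(x,y) = x1 y1 / (a - lambda) + x2 y2 / (b - lambda), cleared of denominators,
   satisfies L^2 = g with g = s (a s - 1) (b s - 1) (lam s - 1) fixed by the
   caustic, and one bounce conjugates L by
     [[1, 0], [- c s, 1]] [[1, t], [0, 1]].
   The product M(s) of n such factors has degree n and determinant 1, and at
   s = 1/a, resp. s = 1/b, it carries the first, resp. second, coordinates of
   (p, v) at time 0 to those at time n.
   If the n-th state is the mirror image of the initial one under signs sx, sy,
   then M commutes with L, hence M = S + Q L with S^2 - g Q^2 = 1, S(0) = 1,
   S(1/a) = sx, S(1/b) = sy. Since S - 1 and S + 1 are coprime, each is a constant
   times a partial product of the roots of g times a square; this is the equation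
   of the theorem, and the signs of S -+ 1 between 1/b and 1/lam exclude the
   remaining distributions of the roots.
   Conversely, a solution (S, Q) gives N = S + Q L of degree n, and comparing
   leading coefficients in N M_k^-1 (S - Q L_k) = M_k^-1 shows that N M_k^-1 has
   degree at most n - k; so N and M agree up to a unipotent constant, which the
   boundary ellipse forces to be trivial. *)
Require Import Defs.
From mathcomp Require Import all_boot all_order all_algebra.
From mathcomp Require Import reals zify ring lra.

Set Implicit Arguments.
Unset Strict Implicit.
Unset Printing Implicit Defensive.

Import Order.TTheory GRing.Theory Num.Theory.
Local Open Scope ring_scope.

(** * Polynomial Pell equations *)

Lemma coefM_top (R : idomainType) (p q : {poly R}) (i j : nat) :
  (size p <= i.+1)%N -> (size q <= j.+1)%N ->
  (p * q)`_(i + j) = p`_i * q`_j.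
Proof.
move=> sp sq; rewrite coefM.
have hi : (i < (i + j).+1)%N by rewrite ltnS leq_addr.
rewrite (bigD1 (Ordinal hi)) //= addKn big1 ?addr0 // => k nek.
have [lt_ik | le_ki] := ltnP i k.
  by rewrite (nth_default 0 (leq_trans sp lt_ik)) mul0r.
have lt_ki : (k < i)%N.
  by rewrite ltn_neqAle le_ki andbT; apply: contra nek => /eqP e; apply/eqP/val_inj.
rewrite [q`__]nth_default ?mulr0 //; apply: leq_trans sq _.
by rewrite ltn_subRL ltn_add2r.
Qed.

Lemma size_pred_coef (R : nzRingType) (p : {poly R}) (d : nat) :
  (size p <= d.+1)%N -> p`_d = 0 -> (size p <= d)%N.
Proof.
move=> sp pd0; apply/leq_sizeP => j; rewrite leq_eqVlt => /orP[/eqP <- // | ltdj].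
exact/nth_default/(leq_trans sp).
Qed.

(** With D = gcd(A, Q), A = A1 D and Q = Q1 D, cancelling gives A1 B = Q1^2 D. Since A1 is prime to
    Q1 and D is prime to B, A1 and D divide each other, and A is associate to D^2. *)
Lemma coprime_mul_square (F : fieldType) (A B Q : {poly F}) :
  coprimep A B -> A * B = Q ^+ 2 -> exists c p, A = c *: p ^+ 2.
Proof.
move=> coAB AB; exists (lead_coef A / lead_coef (gcdp A Q ^+ 2)), (gcdp A Q).
apply: eqpfP; rewrite eqp_sym; set D := gcdp A Q.
have [D0 | nzD] := eqVneq D 0.
  have /eqP A0 : A == 0 by have := gcdp_eq0 A Q; rewrite -/D D0 eqxx => /esym/andP[].
  by rewrite D0 A0 expr0n /= eqpxx.
have [A1 defA] : exists A1, A = A1 * D.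
  by have /dvdpP[A1 ->] := dvdp_gcdl A Q; exists A1.
have [Q1 defQ] : exists Q1, Q = Q1 * D.
  by have /dvdpP[Q1 ->] := dvdp_gcdr A Q; exists Q1.
have DdA : D %| A by apply: dvdp_gcdl.
have gcdD d : d %| A -> d %| Q -> d %| D by move=> dA dQ; rewrite dvdp_gcd dA.
clearbody D.
have coA1Q1 : coprimep A1 Q1.
  apply/coprimepP => d dA dQ.
  have : d * D %| D by apply: gcdD; rewrite ?defA ?defQ dvdp_mul2r.
  by rewrite -{2}[D]mul1r dvdp_mul2r // dvdp1 size_poly_eq1.
have e1 : A1 * B = Q1 ^+ 2 * D.
  by apply: (mulIf nzD); rewrite mulrAC -defA AB defQ; ring.
have dA1 : A1 %| D.
  have : A1 %| Q1 ^+ 2 * D by rewrite -e1 dvdp_mulr.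
  by rewrite Gauss_dvdpr // coprimep_expr.
have dD : D %| A1.
  have : D %| A1 * B by rewrite e1 dvdp_mull.
  by rewrite Gauss_dvdpl //; apply: coprimep_dvdr DdA coAB.
have : D %= A1 by rewrite /eqp dA1 dD.
by rewrite {1}defA expr2 eqp_mul2r.
Qed.

(** The sign e stays outside and a real square root absorbs the positive rest. The factor 2 is kept
    because S + 1 and S - 1 differ by 2. *)
Lemma scaled_square_rescale (R : rcfType) (e c : R) (F S p : {poly R}) :
  e ^+ 2 = 1 -> F \is monic -> S = c *: p ^+ 2 * F -> 0 < e * lead_coef S ->
  exists p', S = (e * 2) *: (F * p' ^+ 2).
Proof.
move=> e2 monF defS; rewrite defS lead_coef_Mmonic // lead_coefZ lead_coef_exp.
rewrite mulrA => ec_gt0.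
have ec : 0 < e * c.
  rewrite ltNge; apply: contraTN ec_gt0 => ec_le0.
  by rewrite -leNgt mulr_le0_ge0 ?sqr_ge0.
exists (Num.sqrt (e * c / 2) *: p).
have sq : Num.sqrt (e * c / 2) ^+ 2 = e * c / 2.
  by rewrite sqr_sqrtr // divr_ge0 ?ler0n ?(ltW ec).
rewrite exprZn sq -scalerAr scalerA.
have -> : e * 2 * (e * c / 2) = e ^+ 2 * c by field.
rewrite e2 mul1r.
by rewrite -scalerAl mulrC.
Qed.

Lemma size_prod_square (R : idomainType) (rs : seq R) (p : {poly R}) : p != 0 ->
  (size ((\prod_(r <- rs) ('X - r%:P)) * p ^+ 2)%R).+1 = ((size p).*2 + size rs)%N.
Proof.
move=> p0; rewrite size_monicM ?monic_prod_XsubC ?expf_neq0 // size_prod_XsubC.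
rewrite expr2 size_mul //; move: p0; rewrite -size_poly_gt0.
case: (size p) => // k _.
by rewrite -addnn !(addSn, addnS) /= addnC.
Qed.

Lemma pell_sqr_at_root (R : idomainType) (kappa r : R) (P Q : {poly R}) (rs : seq R) :
  P ^+ 2 - 1 = kappa *: (\prod_(z <- rs) ('X - z%:P)) * Q ^+ 2 ->
  r \in rs -> P.[r] ^+ 2 = 1.
Proof.
move=> pell rrs; have /eqP r0 : root (\prod_(z <- rs) ('X - z%:P)) r.
  by rewrite root_prod_XsubC.
apply/eqP; rewrite -subr_eq0; apply/eqP; have := congr1 (horner^~ r) pell.
by rewrite hornerM hornerZ r0 mulr0 mul0r !hornerE.
Qed.

(** P - 1 and P + 1 differ by 2, hence are coprime; each root in [rs] belongs to exactly one of
    them, and the cofactors multiply to a square. As P has positive degree, both inherit its degree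
    and leading coefficient. *)
Lemma pell_split (R : rcfType) (n : nat) (kappa : R) (P Q : {poly R}) (rs : seq R) :
  uniq rs -> size P = n.+2 -> 0 < (-1) ^+ n.+1 * lead_coef P -> 0 <= kappa ->
  P ^+ 2 - 1 = kappa *: (\prod_(r <- rs) ('X - r%:P)) * Q ^+ 2 ->
  exists p q,
    [/\ P - 1 = ((-1) ^+ n.+1 * 2) *: (\prod_(r <- rs | P.[r] == 1) ('X - r%:P) * p ^+ 2),
        P + 1 = ((-1) ^+ n.+1 * 2) *: (\prod_(r <- rs | P.[r] == -1) ('X - r%:P) * q ^+ 2),
        ((size p).*2 + count (fun r => P.[r] == 1)%R rs)%N = n.+3 &
        ((size q).*2 + count (fun r => P.[r] == -1)%R rs)%N = n.+3].
Proof.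
move=> uniq_rs sP lP k_ge0 pell.
have Pr r : r \in rs -> (P.[r] == 1) || (P.[r] == -1).
  by move=> rrs; rewrite -eqf_sqr expr1n (pell_sqr_at_root pell rrs).
have dvd c : \prod_(r <- rs | P.[r] == c) ('X - r%:P) %| P - c%:P.
  rewrite -big_filter uniq_roots_dvdp ?uniq_rootsE ?filter_uniq //.
  apply/allP => r; rewrite mem_filter => /andP[/eqP Prc _].
  by rewrite /root !hornerE Prc subrr.
have monic_prod c : \prod_(r <- rs | P.[r] == c) ('X - r%:P) \is monic.
  by apply: monic_prod => r _; apply: monicXsubC.
have /dvdpP[A defA] := dvd 1; have /dvdpP[B defB] := dvd (-1).
have prodE : \prod_(r <- rs) ('X - r%:P) =
    \prod_(r <- rs | P.[r] == 1) ('X - r%:P) * \prod_(r <- rs | P.[r] == -1) ('X - r%:P).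
  rewrite (bigID (fun r => P.[r] == 1)) /=; congr (_ * _).
  rewrite big_seq_cond [RHS]big_seq_cond; apply: eq_bigl => r.
  case rrs: (r \in rs) => //=; have /orP[/eqP-> | /eqP->] := Pr r rrs.
    by rewrite eqxx; apply/esym/negbTE; rewrite -subr_eq0 opprK -mulr2n pnatr_eq0.
  by rewrite eqxx -subr_eq0 -opprD oppr_eq0 -mulr2n pnatr_eq0.
move: prodE defA defB (monic_prod 1) (monic_prod (-1)).
set F1 := \prod_(r <- rs | P.[r] == 1) _; set F2 := \prod_(r <- rs | P.[r] == -1) _.
rewrite polyCN opprK => prodE defA defB mon1 mon2.
have AB : A * B = (Num.sqrt kappa *: Q) ^+ 2.
  rewrite exprZn sqr_sqrtr //.
  apply: (mulIf (mulf_neq0 (monic_neq0 mon1) (monic_neq0 mon2))).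
  rewrite -!scalerAl mulrACA -defA -defB -[Q ^+ 2 * _]mulrC scalerAl -prodE -pell.
  by ring.
have coAB : coprimep A B.
  apply/coprimepP => d dA dB; rewrite -size_poly_eq1 -dvdp1.
  have -> : 1 = 2^-1 *: ((P + 1%:P) - (P - 1%:P)) :> {poly R}.
    have -> : P + 1%:P - (P - 1%:P) = 2%:P by ring.
    by rewrite -mul_polyC -polyCM mulVf ?pnatr_eq0.
  by rewrite dvdpZr ?invr_eq0 ?pnatr_eq0 // dvdp_sub // ?defA ?defB dvdp_mulr.
have [c1 [p1 Ap]] := coprime_mul_square coAB AB.
have [c2 [p2 Bp]] : exists c p, B = c *: p ^+ 2.
  by apply: (@coprime_mul_square _ B A); [rewrite coprimep_sym | rewrite mulrC AB].
have lead_shift c : lead_coef (P + c%:P) = lead_coef P.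
  by rewrite lead_coefDl // sP (leq_ltn_trans (size_polyC_leq1 _)).
have sgn2 : ((-1) ^+ n.+1) ^+ 2 = 1 :> R by rewrite sqrr_sign.
rewrite Ap in defA; rewrite Bp in defB.
have [|p' p'P] := scaled_square_rescale sgn2 mon1 defA.
  by rewrite -polyCN lead_shift.
have [|q' q'P] := scaled_square_rescale sgn2 mon2 defB.
  by rewrite lead_shift.
have sizes c S : (-1) ^+ n.+1 * 2 != 0 :> R -> P - c%:P =
    ((-1) ^+ n.+1 * 2) *: (\prod_(r <- rs | P.[r] == c) ('X - r%:P) * S ^+ 2) ->
    ((size S).*2 + count (fun r => P.[r] == c)%R rs)%N = n.+3.
  move=> nz SE; have sPc : size (P - c%:P) = n.+2.
    by rewrite size_polyDl // -polyCN sP (leq_ltn_trans (size_polyC_leq1 _)).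
  rewrite -size_filter -size_prod_square; last first.
    by apply: contra_eq_neq sPc => S0; rewrite SE S0 expr0n mulr0 scaler0 size_poly0.
  by rewrite big_filter -sPc SE size_scale.
have nz : (-1) ^+ n.+1 * 2 != 0 :> R by rewrite mulf_neq0 ?signr_eq0 ?pnatr_eq0.
exists p', q'; split=> //; first exact: (sizes _ _ nz p'P).
by apply: (sizes _ _ nz); rewrite polyCN opprK.
Qed.

(** * Lax pair *)

Section LaxFlow.

Variable R : realFieldType.
Implicit Types (w h u e : R) (k : nat).

(** A flight of length t followed by a kick c, in one coordinate of position and velocity. The ring
    is arbitrary because s is used both as the indeterminate and as the number 1/a or 1/b. *)
Definition step (A : comPzRingType) (s t c : A) (z : A * A) : A * A :=
  (z.1 + t * z.2, z.2 - c * s * (z.1 + t * z.2)).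

(* The inverse of [step], acting on rows instead of columns. *)
Definition costep (A : comPzRingType) (s t c : A) (r : A * A) : A * A :=
  (r.1 + c * s * (r.2 - t * r.1), r.2 - t * r.1).

Fixpoint flow (A : comPzRingType) (s : A) (t c : nat -> A) k (z : A * A) :=
  if k is j.+1 then step s (t j) (c j) (flow s t c j z) else z.

Fixpoint coflow (A : comPzRingType) (s : A) (t c : nat -> A) k (r : A * A) :=
  if k is j.+1 then costep s (t j) (c j) (coflow s t c j r) else r.

Lemma coflow_flow (A : comPzRingType) (s : A) (t c : nat -> A) k (r z : A * A) :
  (coflow s t c k r).1 * (flow s t c k z).1 + (coflow s t c k r).2 * (flow s t c k z).2
  = r.1 * z.1 + r.2 * z.2.
Proof. by elim: k => //= k <-; rewrite /step /costep /=; ring. Qed.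

Lemma flow_linear (A : comPzRingType) (s : A) (t c : nat -> A) k (x y : A) (z z' : A * A) :
  flow s t c k (x * z.1 + y * z'.1, x * z.2 + y * z'.2) =
  (x * (flow s t c k z).1 + y * (flow s t c k z').1,
   x * (flow s t c k z).2 + y * (flow s t c k z').2).
Proof.
by elim: k => //= k ->; rewrite /step /=; congr (_, _); ring.
Qed.

Lemma flow_horner (t c : nat -> R) k (z : {poly R} * {poly R}) (s : R) :
  let zk := flow 'X (polyC \o t) (polyC \o c) k z in
  flow s t c k (z.1.[s], z.2.[s]) = (zk.1.[s], zk.2.[s]).
Proof.
elim: k => //= k ->; rewrite /step /=; congr (_, _).
  by rewrite !hornerE.
by rewrite !hornerE.
Qed.

(* L = [[lax11, lax12], [lax21, - lax11]] at a point p of the boundary, with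
   w = b p1 v1 + a p2 v2, h = <p, v>, u = b v1^2 + a v2^2, e = a + b - |p|^2;
   the s^2 coefficient of lax12 vanishes by the equation of the boundary. *)
Definition lax11 w h : {poly R} := w%:P * 'X^2 - h%:P * 'X.
Definition lax12 e : {poly R} := 1 - e%:P * 'X.
Definition lax21 u : {poly R} := u%:P * 'X^2 - 'X.

(** The billiard map on the entries of L. The first two equations recover flight and kick from u and
    e; w is conserved. *)
Definition lax_orbit w (h u e t c : nat -> R) := forall k,
  [/\ t k * u k = - 2 * w, c k * e k.+1 = - 2 * w, h k.+1 = h k + t k - c k,
      u k.+1 = u k + 2 * c k * (h k + t k) - c k ^+ 2 &
      e k.+1 = e k - 2 * t k * h k - t k ^+ 2].

Definition laxmul w h u e (z : {poly R} * {poly R}) :=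
  (lax11 w h * z.1 + lax12 e * z.2, lax21 u * z.1 - lax11 w h * z.2).

(** The row r times P - Q L, which inverts P + Q L when the Pell equation holds. *)
Definition laxrow w h u e (P Q : {poly R}) (r : {poly R} * {poly R}) :=
  (r.1 * (P - Q * lax11 w h) - r.2 * Q * lax21 u,
   r.2 * (P + Q * lax11 w h) - r.1 * Q * lax12 e).

Variables (w : R) (h u e t c : nat -> R).
Hypothesis orbit : lax_orbit w h u e t c.

Let F := flow 'X (polyC \o t) (polyC \o c).
Let G := coflow 'X (polyC \o t) (polyC \o c).

(** One bounce T satisfies L_(k+1) T = T L_k identically in s, modulo the relations t u = -2 w and c
    e' = -2 w, where e' is the next value of e. *)
Lemma laxmul_flow k z :
  laxmul w (h k) (u k) (e k) (F k z) = F k (laxmul w (h 0) (u 0) (e 0) z).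
Proof.
elim: k => //= k IH; rewrite /F /= -/F -IH.
have [tu ce hS uS eS] := orbit k.
(* Solving for the old e leaves only the new one, which is the one in the kick relation. *)
have {}eS : e k = e k.+1 + 2 * t k * h k + t k ^+ 2 by rewrite eS; ring.
have tuP : (t k)%:P * (u k)%:P = - 2 * w%:P :> {poly R}.
  by rewrite -polyCM tu; ring.
have ceP : (c k)%:P * (e k.+1)%:P = - 2 * w%:P :> {poly R}.
  by rewrite -polyCM ce; ring.
rewrite /laxmul /step /lax11 /lax12 /lax21 hS uS eS /=.
move: (F k z) => [z1 z2] /=; congr (_, _).
  ring: tuP ceP.
ring: tuP ceP.
Qed.

Lemma laxrow_coflow P Q k r :
  laxrow w (h k) (u k) (e k) P Q (G k r) = G k (laxrow w (h 0) (u 0) (e 0) P Q r).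
Proof.
elim: k => //= k IH; rewrite /G /= -/G -IH.
have [tu ce hS uS eS] := orbit k.
have {}eS : e k = e k.+1 + 2 * t k * h k + t k ^+ 2 by rewrite eS; ring.
have tuP : (t k)%:P * (u k)%:P = - 2 * w%:P :> {poly R}.
  by rewrite -polyCM tu; ring.
have ceP : (c k)%:P * (e k.+1)%:P = - 2 * w%:P :> {poly R}.
  by rewrite -polyCM ce; ring.
rewrite /laxrow /costep /lax11 /lax12 /lax21 hS uS eS /=.
move: (G k r) => [z1 z2] /=; congr (_, _).
  ring: tuP ceP.
ring: tuP ceP.
Qed.

(** * Degrees and leading coefficients of the monodromy matrix *)

Lemma size_polyCXM (a : R) (p : {poly R}) k :
  (size p <= k)%N -> (size (a%:P * 'X * p)%R <= k.+1)%N.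
Proof.
move=> sp; rewrite -mulrA mul_polyC (leq_trans (size_scale_leq _ _)) //.
rewrite mulrC; have [->|pn0] := eqVneq p 0; first by rewrite mul0r size_poly0.
by rewrite size_mulX.
Qed.

Lemma size_polyCM (a : R) (p : {poly R}) k :
  (size p <= k)%N -> (size (a%:P * p)%R <= k)%N.
Proof. by move=> sp; rewrite mul_polyC (leq_trans (size_scale_leq _ _)). Qed.

Lemma size_polyD_leq (p q : {poly R}) k :
  (size p <= k)%N -> (size q <= k)%N -> (size (p + q)%R <= k)%N.
Proof. by move=> sp sq; rewrite (leq_trans (size_polyD _ _)) // geq_max sp sq. Qed.

Lemma size_flow k (z : {poly R} * {poly R}) : (size z.1 <= 1)%N -> (size z.2 <= 1)%N ->
  (size (F k z).1 <= k.+1)%N /\ (size (F k z).2 <= k.+1)%N.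
Proof.
move=> s1 s2; elim: k => // k [IH1 IH2]; rewrite /F /= -/F /step /=.
have s3 : (size ((F k z).1 + (t k)%:P * (F k z).2)%R <= k.+1)%N.
  by rewrite size_polyD_leq // size_polyCM.
split; first exact: leqW.
by rewrite size_polyD_leq ?size_polyN ?size_polyCXM // leqW.
Qed.

Lemma size_coflow k (r : {poly R} * {poly R}) : (size r.1 <= 1)%N -> (size r.2 <= 1)%N ->
  (size (G k r).1 <= k.+1)%N /\ (size (G k r).2 <= k.+1)%N.
Proof.
move=> s1 s2; elim: k => // k [IH1 IH2]; rewrite /G /= -/G /costep /=.
have s3 : (size ((G k r).2 - (t k)%:P * (G k r).1)%R <= k.+1)%N.
  by rewrite size_polyD_leq // size_polyN size_polyCM.
by split; [apply: size_polyD_leq; [apply: leqW | apply: size_polyCXM] | apply: leqW].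
Qed.

Lemma coef_flow_top k (z : {poly R} * {poly R}) : (size z.1 <= 1)%N -> (size z.2 <= 1)%N ->
  (F k.+1 z).1`_k.+1 = 0 /\
  (F k.+1 z).2`_k.+1 = - c k * ((F k z).1`_k + t k * (F k z).2`_k).
Proof.
move=> s1 s2; have [s3 s4] := size_flow k s1 s2.
rewrite /F /= -/F /step /=; split.
  by rewrite coefD coefCM !nth_default // mulr0 addr0.
rewrite coefB -mulrA coefCM coefXM /= coefD coefCM [(F k z).2`_k.+1]nth_default //.
by rewrite sub0r mulNr.
Qed.

(** Only the kicks contain s. This coefficient will fix the sign of the leading coefficient of half
    the trace. *)
Lemma coef_flow_e2 k :
  (F k (0, 1)).1`_k = 0 /\ (F k (0, 1)).2`_k = \prod_(j < k) (- c j * t j).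
Proof.
elim: k => [|k [IH1 IH2]]; first by rewrite /= coef0 coefC big_ord0.
have [|| -> ->] := @coef_flow_top k (0, 1); rewrite ?size_poly0 ?size_poly1 //.
by split=> //; rewrite IH1 IH2 big_ord_recr /= add0r; ring.
Qed.

Lemma flow_det k (z z' : {poly R} * {poly R}) :
  (F k z).1 * (F k z').2 - (F k z').1 * (F k z).2 = z.1 * z'.2 - z'.1 * z.2.
Proof. by elim: k => //= k <-; rewrite /F /= -/F /step /=; ring. Qed.

(** At s = 0 the kicks disappear and the flights compose to a unipotent matrix. *)
Lemma flow_at0 k (z : {poly R} * {poly R}) :
  exists T, (F k z).1.[0] = z.1.[0] + T * z.2.[0] /\ (F k z).2.[0] = z.2.[0].
Proof.
elim: k => [|k [T [IH1 IH2]]]; first by exists 0; rewrite mul0r addr0.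
exists (T + t k); rewrite /F /= -/F /step /= !hornerE IH1 IH2; split; ring.
Qed.

Lemma flow_columns k (x y : {poly R}) :
  F k (x, y) = (x * (F k (1, 0)).1 + y * (F k (0, 1)).1,
                x * (F k (1, 0)).2 + y * (F k (0, 1)).2).
Proof. by rewrite -flow_linear /= !mulr0 !mulr1 addr0 add0r. Qed.

(** M commutes with L = [[A, B], [C, -A]], which gives B m21 = C m12 and B (m11 - m22) = 2 A m12.
    Hence B divides m12, and the quotient Q yields M = P + Q L with P half the trace. *)
Lemma lax_monodromy n : (0 < n)%N -> h n = h 0 -> u n = u 0 -> e n = e 0 ->
  (forall s, (lax12 (e 0)).[s] = 0 -> (lax21 (u 0)).[s] = 0 -> (lax11 w (h 0)).[s] != 0) ->
  exists P Q : {poly R},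
    [/\ forall z, F n z = (P * z.1 + Q * (laxmul w (h 0) (u 0) (e 0) z).1,
                           P * z.2 + Q * (laxmul w (h 0) (u 0) (e 0) z).2),
        P ^+ 2 - (lax11 w (h 0) ^+ 2 + lax12 (e 0) * lax21 (u 0)) * Q ^+ 2 = 1,
        P.[0] = 1, (size P <= n.+1)%N & P`_n = 2^-1 * \prod_(j < n) (- c j * t j)].
Proof.
move=> n_gt0 hn un en nonsing.
have comm z : laxmul w (h 0) (u 0) (e 0) (F n z) = F n (laxmul w (h 0) (u 0) (e 0) z).
  by rewrite -{1}hn -{1}un -{1}en laxmul_flow.
have := comm (0, 1); have := comm (1, 0).
have [s11 s21] : (size (F n (1, 0)%R).1 <= n.+1)%N /\ (size (F n (1, 0)%R).2 <= n.+1)%N.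
  by apply: size_flow; rewrite ?size_poly0 ?size_poly1.
have [s12 s22] : (size (F n (0, 1)%R).1 <= n.+1)%N /\ (size (F n (0, 1)%R).2 <= n.+1)%N.
  by apply: size_flow; rewrite ?size_poly0 ?size_poly1.
have det := flow_det n (1, 0) (0, 1).
have [T [_ m22_0]] := flow_at0 n (0, 1).
have [_ top22] := coef_flow_e2 n.
have top11 : (F n (1, 0)).1`_n = 0.
  case: (n) n_gt0 => // k _.
  by have [|| -> _] := @coef_flow_top k (1, 0); rewrite ?size_poly0 ?size_poly1.
rewrite [F n (laxmul _ _ _ _ (1, 0))]flow_columns [F n (laxmul _ _ _ _ (0, 1))]flow_columns.
have colE := flow_columns n.
move: s11 s21 s12 s22 det m22_0 top22 top11 colE.
case: (F n (1, 0)) => m11 m21; case: (F n (0, 1)) => m12 m22 /=.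
set A := lax11 w (h 0); set B := lax12 (e 0); set C := lax21 (u 0).
move=> s11 s21 s12 s22 det m22_0 top22 top11 colE.
rewrite /laxmul /= -/A -/B -/C !mulr1 !mulr0 !addr0 !subr0 !add0r.
case=> c1 c2; case=> c3 c4.
have A0 : A.[0] = 0.
  by rewrite /A /lax11 !hornerE /= !mulr0 subrr.
have BE : B = 1 - (e 0)%:P * 'X by [].
rewrite -/A -/B -/C in nonsing; clearbody A B C.
have B0 : B != 0.
  apply/eqP => /(congr1 (horner^~ 0)) /eqP.
  by rewrite BE !hornerE ?mulr0 ?subr0 oner_eq0.
(* B is constant or has the single root 1/e. There C m12 = 0 and A m12 = 0, while A or C is
   nonzero. *)
have /dvdpP[Q m12E] : B %| m12.
  have [e0 | en0] := eqVneq (e 0) 0.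
    by rewrite BE e0 mul0r subr0 dvd1p.
  have -> : B = - e 0 *: ('X - (e 0)^-1%:P).
    by rewrite BE -mul_polyC mulrBr -polyCM mulNr mulfV // polyCN; ring.
  rewrite dvdpZl ?oppr_eq0 // dvdp_XsubCl /root.
  have Br : B.[(e 0)^-1] = 0 by rewrite BE !hornerE mulfV ?subrr.
  have := congr1 (horner^~ (e 0)^-1) c3; have := congr1 (horner^~ (e 0)^-1) c1.
  rewrite /= !(hornerD, hornerN, hornerM) Br !mul0r => e1 e3.
  have [Cr | Cr] := eqVneq C.[(e 0)^-1] 0.
    have Ar : A.[(e 0)^-1] != 0 by apply: nonsing.
    rewrite -(mulrI_eq0 _ (lregP Ar)).
    move/eqP: e3; rewrite -subr_eq0 => /eqP e3; apply/eqP.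
    lra.
  rewrite -(mulrI_eq0 _ (lregP Cr)); apply/eqP; lra.
have m21E : m21 = Q * C.
  apply: (mulfI B0); move/eqP: c1; rewrite -subr_eq0 m12E => /eqP c1.
  apply/eqP; rewrite -subr_eq0 -c1; apply/eqP; ring.
have dE : m11 - m22 = 2 * Q * A.
  apply: (mulfI B0); move/eqP: c3; rewrite -subr_eq0 m12E => /eqP c3.
  apply/eqP; rewrite -subr_eq0 -(oppr0) -c3; apply/eqP; ring.
exists (m22 + Q * A), Q.
have m11E : m11 = m22 + 2 * Q * A by rewrite -dE; ring.
have PE : m22 + Q * A = 2^-1%:P * (m11 + m22).
  have half : 2^-1%:P * 2 = 1 :> {poly R}.
    by rewrite -[2]/(2%:R) -polyC_natr -polyCM mulVf ?pnatr_eq0.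
  by rewrite -[LHS]mul1r -half m11E; ring.
split.
- by case=> x y; rewrite colE /= m21E m12E m11E; congr (_, _); ring.
- by move: det; rewrite m11E m12E m21E !mulr1 mul0r subr0 => <-; ring.
- by rewrite !hornerE m22_0 A0 !hornerE.
- by rewrite PE size_polyCM // size_polyD_leq.
by rewrite PE coefCM coefD top11 top22 add0r.
Qed.

(* Write N = n + 2 for the degree of P. The right-hand side of
     (r M_k^-1) (P - Q L_k) = r (P - Q L_0) M_k^-1
   has degree at most k, so on the left the coefficient of s^(2N - k) vanishes. *)
Lemma coflow_size_drop n (P Q : {poly R}) (r : {poly R} * {poly R}) :
  w != 0 -> (size P <= n.+3)%N -> (size Q <= n.+1)%N ->
  Q`_n * w = - P`_n.+2 -> P`_n.+2 != 0 ->
  (size r.1 <= n.+3)%N -> (size r.2 <= n.+3)%N ->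
  (size (laxrow w (h 0) (u 0) (e 0) P Q r).1 <= 1)%N ->
  (size (laxrow w (h 0) (u 0) (e 0) P Q r).2 <= 1)%N ->
  forall k, (k <= n.+2)%N ->
    (size (G k r).1 <= (n.+2 - k).+1)%N /\ (size (G k r).2 <= (n.+2 - k).+1)%N.
Proof.
move=> w0 sP sQ QP Pn0 sr1 sr2 sl1 sl2.
have u0 k : u k != 0.
  have [tu _ _ _ _] := orbit k; apply/eqP => uk0; move: tu.
  by rewrite uk0 mulr0 => /esym/eqP; rewrite mulf_eq0 oppr_eq0 pnatr_eq0 (negbTE w0).
have Qn0 : Q`_n != 0.
  by apply: contra_neq Pn0 => Qn0; rewrite -[LHS]opprK -QP Qn0 mul0r oppr0.
have s11 k : (size (lax11 w (h k)) <= 3)%N.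
  rewrite /lax11 size_polyD_leq ?size_polyN ?size_polyCM ?size_polyXn //.
  by rewrite size_polyX.
have s21 k : (size (lax21 (u k)) <= 3)%N.
  by rewrite /lax21 size_polyD_leq ?size_polyN ?size_polyCM ?size_polyXn ?size_polyX.
have sQM (A : {poly R}) : (size A <= 3)%N -> (size (Q * A)%R <= n.+3)%N.
  move=> sA; rewrite (leq_trans (size_polyMleq _ _)) //.
  by have := leq_add sQ sA; rewrite addn3; case: (_ + _)%N.
have Qtop (A : {poly R}) : (size A <= 3)%N -> (Q * A)`_n.+2 = Q`_n * A`_2.
  by move=> sA; rewrite -[n.+2]addn2 coefM_top.
(* The sign of Q is such that the leading terms of P and - Q [lax11] add up instead of cancelling,
   hence the - 2 w. *)
have top (x y : {poly R}) k d : (size x <= d.+1)%N -> (size y <= d.+1)%N ->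
    (x * (P - Q * lax11 w (h k)) - y * Q * lax21 (u k))`_(d + n.+2) =
    Q`_n * (- 2 * w * x`_d - u k * y`_d).
  move=> sx sy; rewrite coefB -mulrA !coefM_top ?size_polyD_leq ?size_polyN ?(sQM _ (s11 k)) ?(sQM _ (s21 k)) //.
  rewrite coefB (Qtop _ (s11 k)) (Qtop _ (s21 k)) /lax11 /lax21 !coefE /=.
  by rewrite -[P`__]opprK -QP; ring.
elim=> [|k IH] lek; first by rewrite subn0.
have [] := IH (ltnW lek); have [d dE] : exists d, n.+2 = (d.+1 + k)%N.
  by exists (n.+1 - k)%N; rewrite addSn subnK.
have -> : (n.+2 - k = d.+1)%N by rewrite dE addnK.
have -> : (n.+2 - k.+1 = d)%N by rewrite dE addSnnS addnK.
move=> sx sy.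
have [sk1 _] := size_coflow k sl1 sl2.
have [sK1 _] := size_coflow k.+1 sl1 sl2.
have rowE j : (G j r).1 * (P - Q * lax11 w (h j)) - (G j r).2 * Q * lax21 (u j)
    = (G j (laxrow w (h 0) (u 0) (e 0) P Q r)).1.
  by rewrite -laxrow_coflow.
(* The coefficient vanishes because k < 2N - k. With t u = -2 w, this says that leading terms cancel
   in y - t x, the second entry of [costep]. *)
have yE : (G k r).2`_d.+1 = t k * (G k r).1`_d.+1.
  have := top _ _ k _ sx sy; rewrite rowE nth_default; last first.
    by rewrite (leq_trans sk1) // dE; rewrite addnA addSn ltnS leq_addl.
  have [tu _ _ _ _] := orbit k.
  move/esym/eqP; rewrite mulf_eq0 (negbTE Qn0) -tu /= => /eqP e3.
  apply: (mulfI (u0 k)); lra.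
have sy' : (size (G k.+1 r).2 <= d.+1)%N.
  apply: size_pred_coef; first by rewrite /G /= -/G size_polyD_leq ?size_polyN ?size_polyCM.
  by rewrite /G /= -/G coefB coefCM yE subrr.
have sx' : (size (G k.+1 r).1 <= d.+2)%N.
  by rewrite /G /= -/G size_polyD_leq // size_polyCXM.
split; last exact: sy'.
apply: (size_pred_coef sx').
(* The same comparison one step later: the second entry has already dropped, so only the first one
   contributes. *)
have := top _ _ k.+1 _ sx' (leqW sy'); rewrite rowE nth_default; last first.
  by rewrite (leq_trans sK1) // dE addnA addSn addnS !addSn !ltnS leq_addl.
move/esym/eqP; rewrite mulf_eq0 (negbTE Qn0) /= [(G k.+1 r).2`_d.+1]nth_default //.
by rewrite mulr0 subr0 !mulf_eq0 oppr_eq0 pnatr_eq0 (negbTE w0) /= => /eqP.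
Qed.

(** With N = P + Q L_0, the degree drop makes N M^-1 constant. At s = 0 both N and M are upper
    unipotent, so this constant is [[1, tau], [0, 1]], with tau still unknown. *)
Lemma lax_monodromy_unique n (P Q : {poly R}) :
  w != 0 -> (size P <= n.+3)%N -> (size Q <= n.+1)%N ->
  Q`_n * w = - P`_n.+2 -> P`_n.+2 != 0 -> P.[0] = 1 ->
  P ^+ 2 - (lax11 w (h 0) ^+ 2 + lax12 (e 0) * lax21 (u 0)) * Q ^+ 2 = 1 ->
  exists tau, forall z,
    let zn := F n.+2 z in let Lz := laxmul w (h 0) (u 0) (e 0) z in
    zn.1 + tau%:P * zn.2 = P * z.1 + Q * Lz.1 /\ zn.2 = P * z.2 + Q * Lz.2.
Proof.
move=> w0 sP sQ QP Pn0 P0 pell.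
have [A AE] : exists A, A = lax11 w (h 0) by exists (lax11 w (h 0)).
have [B BE] : exists B, B = lax12 (e 0) by exists (lax12 (e 0)).
have [C CE] : exists C, C = lax21 (u 0) by exists (lax21 (u 0)).
have sA : (size A <= 3)%N.
  by rewrite ?AE ?CE size_polyD_leq ?size_polyN ?size_polyCM ?size_polyXn ?size_polyX.
have sB : (size B <= 3)%N.
  by rewrite BE size_polyD_leq ?size_polyN ?size_polyCM ?size_poly1 ?size_polyX.
have sC : (size C <= 3)%N.
  by rewrite ?AE ?CE size_polyD_leq ?size_polyN ?size_polyCM ?size_polyXn ?size_polyX.
have A0 : A.[0] = 0 by rewrite AE !hornerE /= !mulr0 subrr.
have C0 : C.[0] = 0 by rewrite CE !hornerE /= !mulr0 subrr.
have sQM (D : {poly R}) : (size D <= 3)%N -> (size (Q * D)%R <= n.+3)%N.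
  move=> sD; rewrite (leq_trans (size_polyMleq _ _)) //.
  by have := leq_add sQ sD; rewrite addn3; case: (_ + _)%N.
have pellABC : P ^+ 2 - (A ^+ 2 + B * C) * Q ^+ 2 = 1 by rewrite AE BE CE.
have drop := coflow_size_drop w0 sP sQ QP Pn0.
(* By the Pell equation P - Q L_0 inverts N, so the rows of N become the constant unit rows required
   by the degree drop. *)
have row1E : laxrow w (h 0) (u 0) (e 0) P Q (P + Q * A, Q * B) = (1, 0).
  by rewrite /laxrow /= -AE -BE -CE -pellABC; congr (_, _); ring.
have row2E : laxrow w (h 0) (u 0) (e 0) P Q (Q * C, P - Q * A) = (0, 1).
  by rewrite /laxrow /= -AE -BE -CE -pellABC; congr (_, _); ring.
have [s1 s2] : (size (G n.+2 (P + Q * A, Q * B)%R).1 <= (n.+2 - n.+2).+1)%N /\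
               (size (G n.+2 (P + Q * A, Q * B)%R).2 <= (n.+2 - n.+2).+1)%N.
  by apply: drop; rewrite ?row1E /= ?size_poly1 ?size_poly0 ?size_polyD_leq ?sQM.
have [s3 s4] : (size (G n.+2 (Q * C, P - Q * A)%R).1 <= (n.+2 - n.+2).+1)%N /\
               (size (G n.+2 (Q * C, P - Q * A)%R).2 <= (n.+2 - n.+2).+1)%N.
  by apply: drop; rewrite ?row2E /= ?size_poly1 ?size_poly0 ?size_polyD_leq ?size_polyN ?sQM.
rewrite subnn in s1 s2 s3 s4.
move: s1 s2 s3 s4; rewrite -/F -/G; move: (n.+2) => N s1 s2 s3 s4.
have row1 z := coflow_flow 'X (polyC \o t) (polyC \o c) N (P + Q * A, Q * B) z.
have row2 z := coflow_flow 'X (polyC \o t) (polyC \o c) N (Q * C, P - Q * A) z.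
rewrite -/F -/G in row1 row2.
have [T1 [/= z10 z20]] := flow_at0 N (1, 0).
have [T2 [_ /= z21]] := flow_at0 N (0, 1).
move: row1 row2 z10 z20 z21 s1 s2 s3 s4.
move: (F N) (G N (P + Q * A, Q * B)) (G N (Q * C, P - Q * A)) => Fn [x1 y1] [x2 y2] /=.
move=> row1 row2 z10 z20 z21 /size1_polyC x1E /size1_polyC y1E /size1_polyC x2E /size1_polyC y2E.
rewrite {}x1E {}y1E in row1; rewrite {}x2E {}y2E in row2.
have x1E : x1`_0 = 1.
  have := congr1 (horner^~ 0) (row1 (1, 0)).
  by rewrite /= !hornerE z10 z20 P0 A0 !hornerE /= ?(mulr0, addr0, mulr1, oppr0).
have x2E : x2`_0 = 0.
  have := congr1 (horner^~ 0) (row2 (1, 0)).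
  by rewrite /= !hornerE z10 z20 C0 !hornerE /= ?(mulr0, addr0, mulr1, oppr0).
have y2E : y2`_0 = 1.
  have := congr1 (horner^~ 0) (row2 (0, 1)).
  by rewrite /= x2E !hornerE z21 P0 A0 !hornerE /= ?(mulr0, addr0, mulr1, subr0).
exists y1`_0 => z; rewrite -AE -BE -CE; split.
  by have := row1 z; rewrite x1E mul1r => ->; ring.
by have := row2 z; rewrite x2E y2E mul0r add0r mul1r => ->; ring.
Qed.

End LaxFlow.

(** * Billiard trajectories and their Lax matrices *)

Section Billiard.

Variable R : realType.
Implicit Types (a b lam : R) (P : nat -> R * R).

(** v is the outgoing velocity, t the chord length, and c the kick along the normal N = (x/a, y/b);
    the last equation states c = 2 <v, N> / <N, N> without a division. *)
Definition unit_speed a b P (v : nat -> R * R) (t c : nat -> R) := forall k,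
  [/\ 0 < t k, (v k).1 ^+ 2 + (v k).2 ^+ 2 = 1,
      P k.+1 = ((P k).1 + t k * (v k).1, (P k).2 + t k * (v k).2),
      v k.+1 = ((v k).1 - c k * ((P k.+1).1 / a), (v k).2 - c k * ((P k.+1).2 / b)) &
      c k * (((P k.+1).1 / a) ^+ 2 + ((P k.+1).2 / b) ^+ 2) =
      2 * ((v k).1 * ((P k.+1).1 / a) + (v k).2 * ((P k.+1).2 / b))].

Lemma on_boundary a b A : 0 < b -> b < a -> on_conic a b 0 A ->
  b * A.1 ^+ 2 + a * A.2 ^+ 2 = a * b.
Proof.
move=> b0 ba; have a0 := lt_trans b0 ba.
rewrite /on_conic !lt_eqF // !subr0 => e.
by rewrite -[RHS]mulr1 -e; field; rewrite !gt_eqF.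
Qed.

Lemma sqr_normD_gt0 (x y : R) : (x, y) <> (0, 0) -> 0 < x ^+ 2 + y ^+ 2.
Proof.
move=> xy0; rewrite lt0r addr_ge0 ?sqr_ge0 // andbT.
apply/negP => /eqP e; apply: xy0.
have /eqP : y ^+ 2 = 0 by have := sqr_ge0 x; have := sqr_ge0 y; lra.
have /eqP : x ^+ 2 = 0 by have := sqr_ge0 x; have := sqr_ge0 y; lra.
by rewrite !sqrf_eq0 => /eqP-> /eqP->.
Qed.

Lemma billiard_unit_speed a b P : 0 < b -> b < a -> billiard_trajectory a b P ->
  exists v t c, unit_speed a b P v t c.
Proof.
move=> b0 ba [onE neP refl]; have a0 := lt_trans b0 ba.
pose dx k := (P k.+1).1 - (P k).1; pose dy k := (P k.+1).2 - (P k).2.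
pose t k := Num.sqrt (dx k ^+ 2 + dy k ^+ 2).
pose v k := (dx k / t k, dy k / t k).
pose N k := ((P k.+1).1 / a, (P k.+1).2 / b).
pose c k := 2 * ((v k).1 * (N k).1 + (v k).2 * (N k).2) / ((N k).1 ^+ 2 + (N k).2 ^+ 2).
have d2 k : 0 < dx k ^+ 2 + dy k ^+ 2.
  apply: sqr_normD_gt0 => -[/eqP]; rewrite subr_eq0 => /eqP e1 /eqP.
  rewrite subr_eq0 => /eqP e2; apply: (neP k).
  by rewrite [LHS]surjective_pairing e1 e2 -surjective_pairing.
have t0 k : 0 < t k by rewrite sqrtr_gt0.
have t2 k : t k ^+ 2 = dx k ^+ 2 + dy k ^+ 2 by rewrite sqr_sqrtr ?ltW.
have N2 k : 0 < (N k).1 ^+ 2 + (N k).2 ^+ 2.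
  apply: sqr_normD_gt0 => -[/eqP]; rewrite mulf_eq0 invr_eq0 (gt_eqF a0) orbF => /eqP e1 /eqP.
  rewrite mulf_eq0 invr_eq0 (gt_eqF b0) orbF => /eqP e2.
  have := on_boundary b0 ba (onE k.+1); rewrite e1 e2 expr0n /= !mulr0 addr0 => /esym/eqP.
  by rewrite mulf_eq0 !gt_eqF.
have M2 k : 0 < ((P k.+1).1 * b) ^+ 2 + ((P k.+1).2 * a) ^+ 2.
  have -> : ((P k.+1).1 * b) ^+ 2 + ((P k.+1).2 * a) ^+ 2
      = (a * b) ^+ 2 * ((N k).1 ^+ 2 + (N k).2 ^+ 2).
    by rewrite /=; field; rewrite !gt_eqF.
  by rewrite mulr_gt0 // exprn_gt0 // mulr_gt0.
have v2 k : (v k).1 ^+ 2 + (v k).2 ^+ 2 = 1.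
  rewrite /= !expr_div_n -mulrDl -t2 mulfV // expf_neq0 // gt_eqF //.
exists v, t, c => k; split=> //; rewrite ?v2 //.
- rewrite [LHS]surjective_pairing; congr (_, _) => /=.
    by rewrite mulrC divfK ?gt_eqF // /dx addrC subrK.
  by rewrite mulrC divfK ?gt_eqF // /dy addrC subrK.
- have [d d0] := refl k; rewrite /reflect_dir /normal_at /dot.
  move=> /= eP.
  have [hx hy] : dx k.+1 = d * t k * ((v k).1 - c k * (N k).1) /\
          dy k.+1 = d * t k * ((v k).2 - c k * (N k).2).
    have := congr1 fst eP; have := congr1 snd eP => /=; rewrite /dx /dy => -> ->.
    have := N2 k; rewrite /c /v /= -/(dx k) -/(dy k) => N2k.
    by split; field; rewrite ?gt_eqF //; apply: M2.
  (* A reflection is an isometry, so the free positive factor d is the ratio of consecutive chord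
     lengths. *)
  have tk : t k.+1 = d * t k.
    have dt0 : 0 < d * t k by rewrite mulr_gt0.
    apply/eqP; rewrite -(@eqrXn2 _ 2) ?(ltW dt0) ?(ltW (t0 _)) // t2 hx hy.
    have e1 : c k * ((N k).1 ^+ 2 + (N k).2 ^+ 2) = 2 * ((v k).1 * (N k).1 + (v k).2 * (N k).2).
      by rewrite divfK ?gt_eqF.
    have e2 := v2 k; move: e1 e2; rewrite /=.
    move: (dx k / t k) (dy k / t k) (c k) (_ / a) (_ / b) => v1 v2' ck n1 n2 e1 e2.
    apply/eqP.
    transitivity ((d * t k) ^+ 2 * ((v1 ^+ 2 + v2' ^+ 2) + ck * (ck * (n1 ^+ 2 + n2 ^+ 2) - 2 * (v1 * n1 + v2' * n2)))).
      ring.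
    by rewrite e1 e2; ring.
  by rewrite /v tk hx hy; congr (_, _); rewrite mulrAC mulfV ?mul1r // gt_eqF // mulr_gt0.
by rewrite divfK ?gt_eqF.
Qed.

(** This is the dual conic: the line with unit normal (V2, -V1) at signed distance A1 V2 - A2 V1
    from the center is tangent when (a - lam) V2^2 + (b - lam) V1^2 is the square of that
    distance. *)
Lemma caustic_direction a b lam A V (t : R) : lam < a -> lam != b -> 0 < t ->
  V.1 ^+ 2 + V.2 ^+ 2 = 1 ->
  line_tangent a b lam A (A.1 + t * V.1, A.2 + t * V.2) ->
  a * V.2 ^+ 2 + b * V.1 ^+ 2 - (A.1 * V.2 - A.2 * V.1) ^+ 2 = lam.
Proof.
move=> la lb t0 V2 [X [Y [Z [XYZ0 conic lineA lineB]]]].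
have al : a - lam != 0 by rewrite subr_eq0 gt_eqF.
have bl : b - lam != 0 by rewrite subr_eq0 eq_sym.
have [al1 XE] : exists al1, X = (a - lam) * al1.
  by exists (X / (a - lam)); rewrite mulrC divfK.
have [be1 YE] : exists be1, Y = (b - lam) * be1.
  by exists (Y / (b - lam)); rewrite mulrC divfK.
have {}conic : (a - lam) * al1 ^+ 2 + (b - lam) * be1 ^+ 2 = Z ^+ 2.
  by rewrite -conic XE YE; field; rewrite al bl.
have {}lineA : A.1 * al1 + A.2 * be1 = Z.
  by rewrite -lineA XE YE; field; rewrite al bl.
have dir : V.1 * al1 + V.2 * be1 = 0.
  apply: (mulfI (lt0r_neq0 t0)).
  have : (A.1 + t * V.1) * al1 + (A.2 + t * V.2) * be1 = Z.
    by rewrite -lineB XE YE /=; field; rewrite al bl.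
  by rewrite -lineA; lra.
(* [al1] and [be1] are the coefficients of the polar line of [X : Y : Z], hence k times (V2,
   -V1). *)
pose k := V.2 * al1 - V.1 * be1.
have alE : al1 = k * V.2.
  have -> : k * V.2 = al1 * (V.1 ^+ 2 + V.2 ^+ 2) - V.1 * (V.1 * al1 + V.2 * be1).
    by rewrite /k; ring.
  by rewrite dir V2 mulr0 subr0 mulr1.
have beE : be1 = - (k * V.1).
  have -> : k * V.1 = V.2 * (V.1 * al1 + V.2 * be1) - be1 * (V.1 ^+ 2 + V.2 ^+ 2).
    by rewrite /k; ring.
  by rewrite dir V2 mulr0 sub0r mulr1 opprK.
have k0 : k != 0.
  apply/eqP => k0; apply: XYZ0.
  by rewrite XE YE -lineA alE beE k0 !mul0r oppr0 !mulr0 addr0.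
apply: (mulfI (expf_neq0 2 k0)).
have : (k * (A.1 * V.2 - A.2 * V.1)) ^+ 2 = Z ^+ 2.
  by rewrite -lineA alE beE; ring.
rewrite -conic alE beE => e.
have -> : k ^+ 2 * lam = k ^+ 2 * lam * (V.1 ^+ 2 + V.2 ^+ 2) by rewrite V2 mulr1.
move: e; rewrite exprMn => e.
by rewrite mulrBr e; ring.
Qed.

(** * Elliptic coordinates and foci *)

Lemma on_conicE a b lam (A : R * R) : b < a ->
  on_conic a b lam A <->
  A.1 ^+ 2 * (b - lam) + A.2 ^+ 2 * (a - lam) = (a - lam) * (b - lam).
Proof.
move=> ba; rewrite /on_conic; case: eqP => [-> | /eqP la].
  rewrite subrr mulr0 addr0 mul0r; split=> [-> | /eqP]; first by rewrite expr0n mul0r.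
  by rewrite mulf_eq0 sqrf_eq0 subr_eq0 (lt_eqF ba) orbF => /eqP.
case: eqP => [-> | /eqP lb].
  rewrite subrr !mulr0 add0r; split=> [-> | /eqP]; first by rewrite expr0n mul0r.
  by rewrite mulf_eq0 sqrf_eq0 subr_eq0 (gt_eqF ba) orbF => /eqP.
have al : a - lam != 0 by rewrite subr_eq0 eq_sym.
have bl : b - lam != 0 by rewrite subr_eq0 eq_sym.
have -> : A.1 ^+ 2 / (a - lam) + A.2 ^+ 2 / (b - lam)
    = (A.1 ^+ 2 * (b - lam) + A.2 ^+ 2 * (a - lam)) / ((a - lam) * (b - lam)).
  by field; rewrite al bl.
split=> [/(canRL (divfK _)) -> | ->]; first by rewrite mul1r // mulf_neq0.
  by rewrite mulf_neq0.
by rewrite mulfV // mulf_neq0.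
Qed.

(** The two conics are linear equations in the squares of the coordinates, with determinant (a -
    b)(l2 - l1). *)
Lemma same_elliptic_coordinates_sqr a b (A B : R * R) : b < a ->
  same_elliptic_coordinates a b A B -> A.1 ^+ 2 = B.1 ^+ 2 /\ A.2 ^+ 2 = B.2 ^+ 2.
Proof.
move=> ba [l1 [l2 [[l12 /(on_conicE _ _ ba) A1 /(on_conicE _ _ ba) A2]
                   [_ /(on_conicE _ _ ba) B1 /(on_conicE _ _ ba) B2]]]].
have sol (X Y : R) : X * (b - l1) + Y * (a - l1) = (a - l1) * (b - l1) ->
    X * (b - l2) + Y * (a - l2) = (a - l2) * (b - l2) ->
    (a - b) * X = (a - l1) * (a - l2) /\ (a - b) * Y = - ((b - l1) * (b - l2)).
  move=> e1 e2; have l0 : l2 - l1 != 0 by rewrite subr_eq0 gt_eqF.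
  split; apply: (mulfI l0).
    transitivity ((a - l2) * (X * (b - l1) + Y * (a - l1))
                  - (a - l1) * (X * (b - l2) + Y * (a - l2))); first by ring.
    by rewrite e1 e2; ring.
  transitivity ((b - l1) * (X * (b - l2) + Y * (a - l2))
                - (b - l2) * (X * (b - l1) + Y * (a - l1))); first by ring.
  by rewrite e1 e2; ring.
have ab : a - b != 0 by rewrite subr_eq0 gt_eqF.
have [eA1 eA2] := sol _ _ A1 A2; have [eB1 eB2] := sol _ _ B1 B2.
by split; apply: (mulfI ab); rewrite ?eA1 ?eA2 ?eB1 ?eB2.
Qed.

(** The elliptic coordinates are the roots of a quadratic that involves only the squares; its
    discriminant [D] vanishes exactly at the foci. *)
Lemma same_elliptic_coordinates_of_sqr a b (A B : R * R) : b < a ->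
  ~ (A.2 = 0 /\ A.1 ^+ 2 = a - b) ->
  A.1 ^+ 2 = B.1 ^+ 2 -> A.2 ^+ 2 = B.2 ^+ 2 -> same_elliptic_coordinates a b A B.
Proof.
move=> ba nofocus AB1 AB2.
pose S := A.1 ^+ 2 + A.2 ^+ 2; pose D := (a - b - S) ^+ 2 + 4 * (a - b) * A.2 ^+ 2.
have ab0 : 0 < a - b by rewrite subr_gt0.
have D_gt0 : 0 < D.
  rewrite lt0r; apply/andP; split; last first.
    by apply: addr_ge0; rewrite ?sqr_ge0 // mulr_ge0 ?sqr_ge0 //; lra.
  apply/eqP => D0; apply: nofocus.
  have y0 : A.2 = 0.
    apply/eqP; rewrite -sqrf_eq0; apply/eqP.
    have := sqr_ge0 (a - b - S); have := sqr_ge0 A.2; move: D0; rewrite /D.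
    move: (A.2 ^+ 2) ((a - b - S) ^+ 2) ab0 => y s d0; nra.
  split=> //; move/eqP: D0; rewrite /D /S y0 expr0n mulr0 !addr0 sqrf_eq0 subr_eq0.
  by move/eqP.
have D2 : Num.sqrt D ^+ 2 = D by rewrite sqr_sqrtr // ltW.
have sD : 0 < Num.sqrt D by rewrite sqrtr_gt0.
have root (l : R) : l = (a + b - S - Num.sqrt D) / 2 \/ l = (a + b - S + Num.sqrt D) / 2 ->
    A.1 ^+ 2 * (b - l) + A.2 ^+ 2 * (a - l) = (a - l) * (b - l).
  move=> lE; have : (2 * l - (a + b - S)) ^+ 2 = D.
    by rewrite -D2; case: lE => ->; field.
  rewrite /D /S => e; apply/eqP; rewrite -subr_eq0; apply/eqP.
  apply: (@mulfI _ 4); first by rewrite pnatr_eq0.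
  rewrite mulr0; transitivity ((a - b - (A.1 ^+ 2 + A.2 ^+ 2)) ^+ 2
    + 4 * (a - b) * A.2 ^+ 2 - (2 * l - (a + b - (A.1 ^+ 2 + A.2 ^+ 2))) ^+ 2).
    by ring.
  by rewrite e subrr.
exists ((a + b - S - Num.sqrt D) / 2), ((a + b - S + Num.sqrt D) / 2).
have lt12 : (a + b - S - Num.sqrt D) / 2 < (a + b - S + Num.sqrt D) / 2 by lra.
have r1 := root _ (or_introl erefl); have r2 := root _ (or_intror erefl).
by split; split=> //; apply/on_conicE => //; rewrite -?AB1 -?AB2.
Qed.

(** The tangents from a focus to a confocal conic are isotropic, hence not real. So elliptic
    coordinates exist all along the trajectory. *)
Lemma line_tangent_off_foci a b lam (A B : R * R) (s : R) : lam < a -> lam != b ->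
  line_tangent a b lam A B ->
  ~ ((1 - s) * A.2 + s * B.2 = 0 /\ ((1 - s) * A.1 + s * B.1) ^+ 2 = a - b).
Proof.
move=> la lb [X [Y [Z [XYZ0 conic lineA lineB]]]] [y0 x2].
have al : a - lam != 0 by rewrite subr_eq0 gt_eqF.
have bl : b - lam != 0 by rewrite subr_eq0 eq_sym.
have ZE : ((1 - s) * A.1 + s * B.1) * (X / (a - lam)) = Z.
  transitivity (((1 - s) * A.1 + s * B.1) * (X / (a - lam))
                + ((1 - s) * A.2 + s * B.2) * (Y / (b - lam))).
    by rewrite y0 mul0r addr0.
  transitivity ((1 - s) * (A.1 * X / (a - lam) + A.2 * Y / (b - lam))
                + s * (B.1 * X / (a - lam) + B.2 * Y / (b - lam))); first by ring.
  by rewrite lineA lineB; ring.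
have e : (X / (a - lam)) ^+ 2 + (Y / (b - lam)) ^+ 2 = 0.
  apply: (mulfI bl); rewrite mulr0.
  have e1 : (a - b) * (X / (a - lam)) ^+ 2 = X ^+ 2 / (a - lam) + Y ^+ 2 / (b - lam).
    by rewrite conic -ZE [RHS]exprMn x2.
  transitivity (X ^+ 2 / (a - lam) + Y ^+ 2 / (b - lam) - (a - b) * (X / (a - lam)) ^+ 2).
    by field; rewrite al bl.
  by rewrite e1 subrr.
have : (X / (a - lam), Y / (b - lam)) = (0, 0).
  by apply/eqP; apply: contraT => /eqP /sqr_normD_gt0; rewrite e ltxx.
case=> /eqP; rewrite mulf_eq0 invr_eq0 (negbTE al) orbF => /eqP X0 /eqP.
rewrite mulf_eq0 invr_eq0 (negbTE bl) orbF => /eqP Y0.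
by apply: XYZ0; rewrite -ZE X0 Y0 mul0r mulr0.
Qed.

(** Equal products exclude independent sign changes at the two ends; when one value is zero, the
    other gives the sign. *)
Lemma common_sign (x0 x1 y0 y1 : R) : y0 ^+ 2 = x0 ^+ 2 -> y1 ^+ 2 = x1 ^+ 2 ->
  y0 * y1 = x0 * x1 -> exists s, [/\ s ^+ 2 = 1, y0 = s * x0 & y1 = s * x1].
Proof.
move=> e0 e1 e01; have [x00 | x0n] := eqVneq x0 0.
  move: e0; rewrite x00 expr0n => /eqP; rewrite sqrf_eq0 => /eqP ->.
  have [x10 | x1n] := eqVneq x1 0.
    move: e1; rewrite x10 expr0n => /eqP; rewrite sqrf_eq0 => /eqP ->.
    by exists 1; rewrite expr1n !mulr0.
  by exists (y1 / x1); rewrite expr_div_n e1 mulfV ?sqrf_eq0 // mulr0 divfK.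
exists (y0 / x0); rewrite expr_div_n e0 mulfV ?sqrf_eq0 // divfK //; split=> //.
apply: (mulfI (expf_neq0 2 x0n)); rewrite -{1}e0.
transitivity (y0 * (y0 * y1)); first by ring.
by rewrite e01; field.
Qed.

Definition scale2 (sx sy : R) (A : R * R) : R * R := (sx * A.1, sy * A.2).

Definition lax_h P v (k : nat) : R := (P k).1 * (v k).1 + (P k).2 * (v k).2.
Definition lax_u a b (v : nat -> R * R) (k : nat) : R :=
  b * (v k).1 ^+ 2 + a * (v k).2 ^+ 2.
Definition lax_e a b P (k : nat) : R := a + b - (P k).1 ^+ 2 - (P k).2 ^+ 2.

(** * Conserved quantities and the Lax matrix of a trajectory *)

Section Invariants.

Variables (a b lam : R) (P v : nat -> R * R) (t c : nat -> R).
Hypotheses (b_gt0 : 0 < b) (b_lt_a : b < a) (lam_gt0 : 0 < lam).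
Hypotheses (lam_neq_a : lam != a) (lam_neq_b : lam != b).
Hypothesis boundary : forall k, b * (P k).1 ^+ 2 + a * (P k).2 ^+ 2 = a * b.
Hypothesis orbit : unit_speed a b P v t c.
Hypothesis caustic : forall k,
  a * (v k).2 ^+ 2 + b * (v k).1 ^+ 2 - ((P k).1 * (v k).2 - (P k).2 * (v k).1) ^+ 2 = lam.

Let w := - Num.sqrt (a * b * lam).
Let a_gt0 : 0 < a. Proof. exact: lt_trans b_lt_a. Qed.

Lemma lax_u_gt0 k : 0 < lax_u a b v k.
Proof.
rewrite /lax_u; have [_ v2 _ _ _] := orbit k; have := sqr_ge0 (v k).2.
have -> : (v k).1 ^+ 2 = 1 - (v k).2 ^+ 2 by lra.
move: b_gt0 b_lt_a; nra.
Qed.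

(* w^2 is determined by Lagrange's identity, its sign by v pointing inwards. *)
Lemma lax_wE k : b * ((P k).1 * (v k).1) + a * ((P k).2 * (v k).2) = w.
Proof.
have [t0 v2 PE _ _] := orbit k; have := boundary k.+1; have := boundary k.
have u0 := lax_u_gt0 k; have := caustic k; rewrite {}PE /=; move: u0 v2 t0.
rewrite /lax_u; move: (P k) (v k) (t k) => [x y] [vx vy] s /=.
set W := b * (x * vx) + a * (y * vy) => u0 v2 s0 la e1 e2.
have W2 : W ^+ 2 = a * b * lam.
  have -> : W ^+ 2 = (b * x ^+ 2 + a * y ^+ 2) * (b * vx ^+ 2 + a * vy ^+ 2)
                     - a * b * (x * vy - y * vx) ^+ 2 by rewrite /W; ring.
  by rewrite e1 -la; ring.
have W0 : W < 0.
  have : s * (2 * W + s * (b * vx ^+ 2 + a * vy ^+ 2)) = 0.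
    transitivity ((b * (x + s * vx) ^+ 2 + a * (y + s * vy) ^+ 2) - (b * x ^+ 2 + a * y ^+ 2)).
      by rewrite /W; ring.
    by rewrite e1 e2 subrr.
  move/eqP; rewrite mulf_eq0 gt_eqF //= => /eqP e3.
  have := mulr_gt0 s0 u0; lra.
by rewrite /w -W2 sqrtr_sqr ltr0_norm // opprK.
Qed.

Lemma lax_w_sqr : w ^+ 2 = a * b * lam.
Proof. by rewrite sqrrN sqr_sqrtr // !mulr_ge0 // ltW. Qed.

Lemma lax_w_lt0 : w < 0.
Proof. by rewrite oppr_lt0 sqrtr_gt0 !mulr_gt0. Qed.

Lemma billiard_lax_orbit : lax_orbit w (lax_h P v) (lax_u a b v) (lax_e a b P) t c.
Proof.
move=> k; have [t0 v2 PE vE cE] := orbit k; have b1 := boundary k; have b2 := boundary k.+1.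
have wE := lax_wE k.
have tu : t k * lax_u a b v k = - 2 * w.
  apply: (mulfI (lt0r_neq0 t0)).
  have : t k * (2 * w + t k * lax_u a b v k) = 0.
    rewrite -wE.
    transitivity ((b * (P k.+1).1 ^+ 2 + a * (P k.+1).2 ^+ 2) - (b * (P k).1 ^+ 2 + a * (P k).2 ^+ 2)).
      by rewrite PE /lax_u /=; ring.
    by rewrite b1 b2 subrr.
  lra.
(* In terms of the normal n, the boundary equation is a n1^2 + b n2^2 = 1 and the next e is a b
   |n|^2, which matches the equation defining c. *)
move: vE cE b2; set n1 := (P k.+1).1 / a; set n2 := (P k.+1).2 / b => vE cE b2.
have xE : (P k.+1).1 = a * n1 by rewrite mulrC divfK ?gt_eqF.
have yE : (P k.+1).2 = b * n2 by rewrite mulrC divfK ?gt_eqF.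
have {}b2 : a * n1 ^+ 2 + b * n2 ^+ 2 = 1.
  apply: (mulfI (mulf_neq0 (lt0r_neq0 a_gt0) (lt0r_neq0 b_gt0))).
  by rewrite mulr1 -[RHS]b2 xE yE; ring.
have hE : lax_h P v k + t k = a * n1 * (v k).1 + b * n2 * (v k).2.
  rewrite -xE -yE PE /lax_h /=.
  by rewrite -[t k in LHS]mulr1 -v2; ring.
split=> //.
- have -> : lax_e a b P k.+1 = a * b * (n1 ^+ 2 + n2 ^+ 2).
    rewrite /lax_e xE yE.
    by rewrite -[a + b]mulr1 -b2; ring.
  rewrite mulrCA cE -wE.
  have -> : - 2 * (b * ((P k).1 * (v k).1) + a * ((P k).2 * (v k).2))
     = 2 * (b * (P k).1 * (v k).1 + a * (P k).2 * (v k).2) + t k * lax_u a b v k * 2.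
    by rewrite tu -wE; ring.
  have : a * n1 = (P k).1 + t k * (v k).1 by rewrite -xE PE.
  have : b * n2 = (P k).2 + t k * (v k).2 by rewrite -yE PE.
  rewrite /lax_u => e1 e2.
  transitivity (2 * (b * (v k).1 * (a * n1) + a * (v k).2 * (b * n2))); first by ring.
  by rewrite e1 e2; ring.
- rewrite hE /lax_h xE yE vE /= -[c k in RHS]mulr1 -b2; ring.
- rewrite hE /lax_u vE /=.
  apply/eqP; rewrite -subr_eq0; apply/eqP.
  transitivity ((a + b) * (c k * (c k * (n1 ^+ 2 + n2 ^+ 2) - 2 * ((v k).1 * n1 + (v k).2 * n2)))
     + c k ^+ 2 * (1 - (a * n1 ^+ 2 + b * n2 ^+ 2))).
    by ring.
  by rewrite cE b2; ring.
transitivity (lax_e a b P k - 2 * t k * lax_h P v k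
              - t k ^+ 2 * ((v k).1 ^+ 2 + (v k).2 ^+ 2)).
  by rewrite /lax_e PE /lax_h /=; ring.
by rewrite v2 mulr1.
Qed.

(** Up to sign, the coefficients of det L are the elementary symmetric functions of a, b and lam;
    [e1], [e2] and [lax_w_sqr] compute them. *)
Lemma lax_curve k :
  lax11 w (lax_h P v k) ^+ 2 + lax12 (lax_e a b P k) * lax21 (lax_u a b v k) =
  (a * b * lam) *: \prod_(r <- [:: 0; 1 / a; 1 / b; 1 / lam]) ('X - r%:P).
Proof.
have [_ v2 _ _ _] := orbit k.
have e1 : lax_h P v k ^+ 2 + lax_u a b v k + lax_e a b P k = a + b + lam.
  rewrite -(caustic k) /lax_h /lax_u /lax_e.
  have -> : a + b - (P k).1 ^+ 2 - (P k).2 ^+ 2 = a + b - ((P k).1 ^+ 2 + (P k).2 ^+ 2) * 1 by ring.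
  by rewrite -v2; ring.
have e2 : 2 * w * lax_h P v k + lax_e a b P k * lax_u a b v k = a * b + lam * (a + b).
  have -> : a * b = (b * (P k).1 ^+ 2 + a * (P k).2 ^+ 2) * ((v k).1 ^+ 2 + (v k).2 ^+ 2).
    by rewrite v2 boundary mulr1.
  by rewrite -(lax_wE k) -(caustic k) /lax_h /lax_u /lax_e; ring.
rewrite !big_cons big_nil mulr1 /lax11 /lax12 /lax21.
move: (lax_h P v k) (lax_u a b v k) (lax_e a b P k) e1 e2 => h u e e1 e2.
transitivity ((w ^+ 2)%:P * 'X^4 - (2 * w * h + e * u)%:P * 'X^3
              + (h ^+ 2 + u + e)%:P * 'X^2 - 'X); first by ring.
rewrite e1 e2 lax_w_sqr.
have root_form (r : R) : r != 0 -> r *: ('X - (1 / r)%:P) = r%:P * 'X - 1 :> {poly R}.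
  by move=> r0; rewrite -mul_polyC mulrBr -polyCM mul1r mulfV.
rewrite subr0.
transitivity ('X * (a *: ('X - (1 / a)%:P)) * (b *: ('X - (1 / b)%:P))
              * (lam *: ('X - (1 / lam)%:P))).
  rewrite !root_form ?gt_eqF //; ring.
by rewrite -!mul_polyC; ring.
Qed.

Lemma lax_branch_uniq : uniq [:: 0; 1 / a; 1 / b; 1 / lam].
Proof.
rewrite /= !inE !negb_or !div1r ![0 == _]eq_sym !invr_eq0 !(inj_eq invr_inj).
by rewrite (gt_eqF a_gt0) (gt_eqF b_gt0) (gt_eqF lam_gt0) (gt_eqF b_lt_a) ![_ == lam]eq_sym lam_neq_a lam_neq_b.
Qed.

(** A zero of the whole matrix would be a double root of g, whose four roots are distinct. *)
Lemma lax_nonsingular k s : (lax12 (lax_e a b P k)).[s] = 0 ->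
  (lax21 (lax_u a b v k)).[s] = 0 -> (lax11 w (lax_h P v k)).[s] != 0.
Proof.
move=> B0 C0; apply/eqP => A0.
have fac (p : {poly R}) : p.[s] = 0 -> exists q, p = q * ('X - s%:P).
  by move=> ps; have /factor_theorem : root p s by apply/eqP.
have [A1 AE] := fac _ A0; have [B1 BE] := fac _ B0; have [C1 CE] := fac _ C0.
have := lax_curve k; rewrite AE BE CE.
set rs := [:: 0; _; _; _] => curve.
have nz : a * b * lam != 0 by rewrite !mulf_neq0 ?gt_eqF.
have s_rs : s \in rs.
  rewrite -root_prod_XsubC; apply/eqP; apply: (mulfI nz).
  by rewrite -hornerZ -curve !hornerE /= subrr !(mulr0, expr0n, addr0).
have := lax_branch_uniq; rewrite -/rs => uniq_rs.
have : s \in rem s rs.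
  rewrite -root_prod_XsubC; apply/eqP; apply: (mulfI nz).
  have: (A1 ^+ 2 + B1 * C1) * ('X - s%:P) = (a * b * lam) *: \prod_(r <- rem s rs) ('X - r%:P).
    apply: (mulIf (negbT (polyXsubC_eq0 s))).

    rewrite -scalerAl [X in _ = _ *: X]mulrC -(big_rem s s_rs (P := xpredT)) -curve.
    by ring.
  by move/(congr1 (horner^~ s)); rewrite /= hornerZ => <-; rewrite !hornerE subrr !mulr0.
by rewrite mem_rem_uniq // inE eqxx.
Qed.

Lemma flow_abscissa k :
  flow (1 / a) t c k ((P 0).1, (v 0).1) = ((P k).1, (v k).1).
Proof.
elim: k => //= k ->; have [_ _ PE vE _] := orbit k.
by rewrite /step /= vE PE /= div1r mulrA mulrAC.
Qed.

Lemma flow_ordinate k :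
  flow (1 / b) t c k ((P 0).2, (v 0).2) = ((P k).2, (v k).2).
Proof.
elim: k => //= k ->; have [_ _ PE vE _] := orbit k.
by rewrite /step /= vE PE /= div1r mulrA mulrAC.
Qed.

(** L(1/a) is a multiple of the column (p1, v1) times the row (v1, -p1), so it kills that column.
    Hence S + Q L acts on it as the number S(1/a), the sign of the mirror symmetry. *)
Lemma laxmul_abscissa k :
  let M := laxmul w (lax_h P v k) (lax_u a b v k) (lax_e a b P k) in
  (M ((P k).1%:P, (v k).1%:P)).1.[1 / a] = 0 /\
  (M ((P k).1%:P, (v k).1%:P)).2.[1 / a] = 0.
Proof.
have [_ v2 _ _ _] := orbit k.
have e1 : w - a * lax_h P v k = (b - a) * ((P k).1 * (v k).1).
  by rewrite -(lax_wE k) /lax_h; ring.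
have e2 : a * (a - lax_e a b P k) = (a - b) * (P k).1 ^+ 2.
  have := boundary k; rewrite /lax_e => e; apply/eqP; rewrite -subr_eq0; apply/eqP.
  transitivity ((b * (P k).1 ^+ 2 + a * (P k).2 ^+ 2) - a * b); first by ring.
  by rewrite e subrr.
have e3 : lax_u a b v k - a = (b - a) * (v k).1 ^+ 2.
  transitivity (lax_u a b v k - a * ((v k).1 ^+ 2 + (v k).2 ^+ 2)); first by rewrite v2 mulr1.
  by rewrite /lax_u; ring.
rewrite /laxmul /lax11 /lax12 /lax21 /=; split.
  transitivity (((w - a * lax_h P v k) * (P k).1 + a * (a - lax_e a b P k) * (v k).1) / a ^+ 2).
    by rewrite !hornerE /=; field; rewrite gt_eqF.
  by rewrite e1 e2 (_ : _ + _ = 0) ?mul0r //; ring.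
transitivity (((lax_u a b v k - a) * (P k).1 - (w - a * lax_h P v k) * (v k).1) / a ^+ 2).
  by rewrite !hornerE /=; field; rewrite gt_eqF.
by rewrite e1 e3 (_ : _ - _ = 0) ?mul0r //; ring.
Qed.

Lemma laxmul_ordinate k :
  let M := laxmul w (lax_h P v k) (lax_u a b v k) (lax_e a b P k) in
  (M ((P k).2%:P, (v k).2%:P)).1.[1 / b] = 0 /\
  (M ((P k).2%:P, (v k).2%:P)).2.[1 / b] = 0.
Proof.
have [_ v2 _ _ _] := orbit k.
have e1 : w - b * lax_h P v k = (a - b) * ((P k).2 * (v k).2).
  by rewrite -(lax_wE k) /lax_h; ring.
have e2 : b * (b - lax_e a b P k) = (b - a) * (P k).2 ^+ 2.
  have := boundary k; rewrite /lax_e => e; apply/eqP; rewrite -subr_eq0; apply/eqP.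
  transitivity ((b * (P k).1 ^+ 2 + a * (P k).2 ^+ 2) - a * b); first by ring.
  by rewrite e subrr.
have e3 : lax_u a b v k - b = (a - b) * (v k).2 ^+ 2.
  transitivity (lax_u a b v k - b * ((v k).1 ^+ 2 + (v k).2 ^+ 2)); first by rewrite v2 mulr1.
  by rewrite /lax_u; ring.
rewrite /laxmul /lax11 /lax12 /lax21 /=; split.
  transitivity (((w - b * lax_h P v k) * (P k).2 + b * (b - lax_e a b P k) * (v k).2) / b ^+ 2).
    by rewrite !hornerE /=; field; rewrite gt_eqF.
  by rewrite e1 e2 (_ : _ + _ = 0) ?mul0r //; ring.
transitivity (((lax_u a b v k - b) * (P k).2 - (w - b * lax_h P v k) * (v k).2) / b ^+ 2).
  by rewrite !hornerE /=; field; rewrite gt_eqF.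
by rewrite e1 e3 (_ : _ - _ = 0) ?mul0r //; ring.
Qed.

(** Motion along the x-axis would force lam = b. *)
Lemma off_abscissa k : ((P k).2, (v k).2) <> (0, 0).
Proof.
move=> [y0 vy0]; have := caustic k; have [_ v2 _ _ _] := orbit k.
move: v2; rewrite y0 vy0 => v2 e; move/eqP: lam_neq_b; apply.
by rewrite -e -[RHS]mulr1 -v2; ring.
Qed.

Lemma off_ordinate k : ((P k).1, (v k).1) <> (0, 0).
Proof.
move=> [y0 vy0]; have := caustic k; have [_ v2 _ _ _] := orbit k.
move: v2; rewrite y0 vy0 => v2 e; move/eqP: lam_neq_a; apply.
by rewrite -e -[RHS]mulr1 -v2; ring.
Qed.

(** * Mirror symmetry and the Pell equation *)

(** Flight and kick depend only on u and e, which are even in the coordinates, so sign changes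
    commute with every bounce. *)
Lemma symmetric_shift n sx sy : sx ^+ 2 = 1 -> sy ^+ 2 = 1 ->
  P n = scale2 sx sy (P 0) -> v n = scale2 sx sy (v 0) ->
  forall k, P (k + n) = scale2 sx sy (P k) /\ v (k + n) = scale2 sx sy (v k).
Proof.
move=> sx2 sy2 Pn vn; elim=> // k [IH1 IH2]; rewrite addSn.
have [tu ce _ _ _] := billiard_lax_orbit k.
have [tu' ce' _ _ _] := billiard_lax_orbit (k + n)%N.
have [_ _ PE vE _] := orbit k; have [_ _ PE' vE' _] := orbit (k + n)%N.
have uE : lax_u a b v (k + n) = lax_u a b v k.
  by rewrite /lax_u IH2 /= !exprMn sx2 sy2 !mul1r.
have tE : t (k + n) = t k.
  by apply: (mulIf (lt0r_neq0 (lax_u_gt0 k))); rewrite tu -{1}uE.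
have P1 : P (k + n).+1 = scale2 sx sy (P k.+1).
  by rewrite PE' PE tE IH1 IH2 /scale2 /=; congr (_, _); ring.
have eE : lax_e a b P (k + n).+1 = lax_e a b P k.+1.
  by rewrite /lax_e P1 /= !exprMn sx2 sy2 !mul1r.
have cE : c (k + n) = c k.
  have e0 : lax_e a b P k.+1 != 0.
    apply: contra_eq_neq ce => ->; rewrite mulr0 eq_sym mulf_neq0 //.
      by rewrite oppr_eq0 pnatr_eq0.
    by rewrite lt_eqF // lax_w_lt0.
  by apply: (mulIf e0); rewrite ce -{1}eE.
by split=> //; rewrite vE' vE P1 cE IH2 /scale2 /=; congr (_, _); ring.
Qed.

Lemma lax_e_gt0 k : 0 < lax_e a b P k.
Proof.
rewrite /lax_e -(pmulr_rgt0 _ b_gt0).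
have -> : b * (a + b - (P k).1 ^+ 2 - (P k).2 ^+ 2) = b ^+ 2 + (a - b) * (P k).2 ^+ 2.
  transitivity (a * b + b ^+ 2 + (a - b) * (P k).2 ^+ 2
                - (b * (P k).1 ^+ 2 + a * (P k).2 ^+ 2)); first by ring.
  by rewrite boundary; ring.
by rewrite ltr_pwDl ?exprn_gt0 // mulr_ge0 ?sqr_ge0 // subr_ge0 ltW.
Qed.

Lemma kick_gt0 k : 0 < c k.
Proof.
have [_ ce _ _ _] := billiard_lax_orbit k.
by rewrite -(pmulr_lgt0 _ (lax_e_gt0 k.+1)) ce; have := lax_w_lt0; lra.
Qed.

Lemma same_scale (x y : R * R) (p s : R) : (x.1, y.1) <> (0, 0) ->
  s * x.1 = p * x.1 -> s * y.1 = p * y.1 -> p = s.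
Proof.
move=> nz ex ey; apply/eqP; rewrite -subr_eq0; apply: contra_notT nz => d0.
congr (_, _); apply: (mulfI d0); rewrite mulr0 mulrBl.
  by rewrite ex subrr.
by rewrite ey subrr.
Qed.

(** Sign changes preserve h, u and e, hence L, so M commutes with L. The leading coefficient of S is
    half a product of n negative factors - c t. *)
Lemma pell_of_symmetric n sx sy : (0 < n)%N -> sx ^+ 2 = 1 -> sy ^+ 2 = 1 ->
  P n = scale2 sx sy (P 0) -> v n = scale2 sx sy (v 0) ->
  exists S Q : {poly R},
    [/\ size S = n.+1, S.[0] = 1, 0 < (-1) ^+ n * lead_coef S,
        S ^+ 2 - 1 = (a * b * lam) *: (\prod_(r <- [:: 0; 1 / a; 1 / b; 1 / lam]) ('X - r%:P))
                     * Q ^+ 2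
      & S.[1 / a] = sx /\ S.[1 / b] = sy].
Proof.
move=> n_gt0 sx2 sy2 Pn vn.
have [|||S [Q [FE pell S0 sS Sn]]] := lax_monodromy billiard_lax_orbit n_gt0 _ _ _ (@lax_nonsingular 0).
- by rewrite /lax_h Pn vn /= mulrACA -expr2 sx2 mul1r [X in _ + X]mulrACA -expr2 sy2 mul1r.
- by rewrite /lax_u vn /= !exprMn sx2 sy2 !mul1r.
- by rewrite /lax_e Pn /= !exprMn sx2 sy2 !mul1r.
have signed : 0 < (-1) ^+ n * S`_n.
  rewrite Sn; elim: (n) => [|k IH]; first by rewrite big_ord0 expr0; lra.
  have [t0 _ _ _ _] := orbit k; have := mulr_gt0 IH (mulr_gt0 (kick_gt0 k) t0).
  by rewrite big_ord_recr exprS /=; congr (_ < _); ring.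
have Sn0 : S`_n != 0 by apply: contraTneq signed => ->; rewrite mulr0 ltxx.
have sSn : size S = n.+1.
  by apply/eqP; rewrite eqn_leq sS ltnNge; apply: contra Sn0 => h; rewrite nth_default.
exists S, Q; split=> //; first by rewrite lead_coefE sSn.
  by rewrite -(lax_curve 0) -pell; ring.
have eval (r x y : R) :
    (laxmul w (lax_h P v 0) (lax_u a b v 0) (lax_e a b P 0) (x%:P, y%:P)).1.[r] = 0 /\
    (laxmul w (lax_h P v 0) (lax_u a b v 0) (lax_e a b P 0) (x%:P, y%:P)).2.[r] = 0 ->
    flow r t c n (x, y) = (S.[r] * x, S.[r] * y).
  move=> [L1 L2]; have := flow_horner t c n (x%:P, y%:P) r.
  by rewrite FE /= !hornerC hornerD !hornerM L1 hornerD !hornerM L2 !mulr0 !addr0 !hornerC.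
have := eval _ _ _ (laxmul_abscissa 0); have := eval _ _ _ (laxmul_ordinate 0).
rewrite flow_abscissa flow_ordinate Pn vn /= => -[ey1 ey2] [ex1 ex2].
split.
  exact: (@same_scale (P 0) (v 0) _ _ (@off_ordinate 0)).
exact: (@same_scale ((P 0).2, 0) ((v 0).2, 0) _ _ (@off_abscissa 0)).
Qed.

(** The Pell equation fixes the leading coefficient of Q up to sign; Q is replaced by - Q where
    necessary. Uniqueness of the monodromy then applies, up to tau. *)
Lemma symmetric_of_pell m (S Q : {poly R}) : size S = m.+3 -> (size Q <= m.+1)%N ->
  S.[0] = 1 ->
  S ^+ 2 - 1 = (a * b * lam) *: (\prod_(r <- [:: 0; 1 / a; 1 / b; 1 / lam]) ('X - r%:P))
               * Q ^+ 2 ->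
  P m.+2 = scale2 S.[1 / a] S.[1 / b] (P 0) /\ v m.+2 = scale2 S.[1 / a] S.[1 / b] (v 0).
Proof.
set rs := [:: 0; _; _; _] => sS sQ S0 pell.
have Sa2 : S.[1 / a] ^+ 2 = 1 by apply: (pell_sqr_at_root pell); rewrite !inE eqxx ?orbT.
have Sb2 : S.[1 / b] ^+ 2 = 1 by apply: (pell_sqr_at_root pell); rewrite !inE eqxx ?orbT.
have w0 : w != 0 by rewrite lt_eqF // lax_w_lt0.
have Sm : S`_m.+2 != 0 by rewrite -[m.+2]/(m.+3.-1) -sS -lead_coefE lead_coef_eq0 -size_poly_eq0 sS.
have lead2 : S`_m.+2 ^+ 2 = (Q`_m * w) ^+ 2.
  have := congr1 (fun p : {poly R} => p`_(m.+2 + m.+2)) pell.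
  rewrite coefB !expr2 coefM_top ?sS // coefC /= subr0 => ->.
  have -> : (m.+2 + m.+2 = 4 + (m + m))%N by rewrite !addSn !addnS.
  have sP : size (\prod_(r <- rs) ('X - r%:P)) = 5%N by rewrite size_prod_XsubC.
  rewrite coefM_top ?(leq_trans (size_scale_leq _ _)) ?sP //; last first.
    by rewrite (leq_trans (size_polyMleq _ _)) //; have := leq_add sQ sQ; rewrite addSn addnS;
       case: (_ + _)%N.
  rewrite coefM_top // coefZ.
  have -> : (\prod_(r <- rs) ('X - r%:P))`_4 = 1.
    by have /monicP := monic_prod_XsubC rs xpredT id; rewrite lead_coefE sP.
  by rewrite mulr1 -lax_w_sqr; ring.
have [Q' [sQ' QS pell']] : exists Q' : {poly R}, [/\ (size Q' <= m.+1)%N, Q'`_m * w = - S`_m.+2 &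
    S ^+ 2 - (lax11 w (lax_h P v 0) ^+ 2 + lax12 (lax_e a b P 0) * lax21 (lax_u a b v 0)) * Q' ^+ 2 = 1].
  move/eqP: lead2; rewrite eqf_sqr => /orP[] /eqP e.
    exists (- Q); rewrite size_polyN coefN mulNr e lax_curve; split=> //.
    by rewrite sqrrN -pell; ring.
  exists Q; rewrite e opprK lax_curve; split=> //.
  by rewrite -pell; ring.
have [] := lax_monodromy_unique billiard_lax_orbit w0 _ sQ' QS Sm S0 pell'; first by rewrite sS.
move=> tau; move: (m.+2) => n FE.
have eval (r x y x' y' : R) :
    (laxmul w (lax_h P v 0) (lax_u a b v 0) (lax_e a b P 0) (x%:P, y%:P)).1.[r] = 0 /\
    (laxmul w (lax_h P v 0) (lax_u a b v 0) (lax_e a b P 0) (x%:P, y%:P)).2.[r] = 0 ->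
    flow r t c n (x, y) = (x', y') -> x' + tau * y' = S.[r] * x /\ y' = S.[r] * y.
  move=> [L1 L2]; have := flow_horner t c n (x%:P, y%:P) r; rewrite /= !hornerC => ->.
  case=> <- <-; have [e1 e2] := FE (x%:P, y%:P).
  move: (congr1 (horner^~ r) e1) (congr1 (horner^~ r) e2).
  rewrite [(_ + _).[r]]hornerD [(_ * _).[r]]hornerM hornerC => ->.
  by rewrite !hornerD !hornerM L1 L2 !hornerC !mulr0 !addr0.
have [x1 x2] := eval _ _ _ _ _ (laxmul_abscissa 0) (flow_abscissa n).
have [y1 y2] := eval _ _ _ _ _ (laxmul_ordinate 0) (flow_ordinate n).
(* Both states have the same w, whereas a shift by tau changes it by - tau u. *)
have tau0 : tau = 0.
  apply: (mulIf (lt0r_neq0 (lax_u_gt0 0))); rewrite mul0r.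
  have := lax_wE n; rewrite -[in RHS](lax_wE 0).
  have -> : (P n).1 = S.[1 / a] * (P 0).1 - tau * (v n).1 by rewrite -x1; ring.
  have -> : (P n).2 = S.[1 / b] * (P 0).2 - tau * (v n).2 by rewrite -y1; ring.
  rewrite x2 y2 => /eqP; rewrite -subr_eq0 => /eqP e.
  apply/eqP; rewrite -oppr_eq0 -e; apply/eqP.
  transitivity (b * (S.[1 / a] ^+ 2 * ((P 0).1 * (v 0).1) - tau * (S.[1 / a] ^+ 2 * (v 0).1 ^+ 2))
     + a * (S.[1 / b] ^+ 2 * ((P 0).2 * (v 0).2) - tau * (S.[1 / b] ^+ 2 * (v 0).2 ^+ 2))
     - (b * ((P 0).1 * (v 0).1) + a * ((P 0).2 * (v 0).2))); last by ring.
  by rewrite Sa2 Sb2 /lax_u; ring.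
move: x1 y1; rewrite tau0 !mul0r !addr0 => x1 y1.
by split; rewrite [LHS]surjective_pairing ?x1 ?x2 ?y1 ?y2.
Qed.

(** * Elliptic periodicity against periodicity *)

(** The ends and the midpoint of the first segment give the squares and the products of the end
    coordinates, hence one sign per coordinate. Equal chord lengths pass the signs on to the
    velocity. *)
Lemma elliptic_periodic_symmetric n : elliptic_periodic a b n P ->
  exists sx sy, [/\ sx ^+ 2 = 1, sy ^+ 2 = 1,
    P n = scale2 sx sy (P 0) & v n = scale2 sx sy (v 0)].
Proof.
move=> ell; have sqr s (s01 : 0 <= s <= 1) :=
  same_elliptic_coordinates_sqr b_lt_a (ell 0 s s01).
have [|x0 y0] := sqr 0; first by rewrite lexx ler01.
have [|x1 y1] := sqr 1; first by rewrite lexx ler01.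
have [|x2 y2] := sqr (1 / 2); first by apply/andP; split; lra.
move: x0 y0 x1 y1 x2 y2; rewrite /moving_point /= add0n.
rewrite !subr0 !mul1r !mul0r !addr0 !subrr !mul0r !add0r => x0 y0 x1 y1 x2 y2.
have [sx [sx2 X0 X1]] := common_sign x0 x1 ltac:(lra).
have [sy [sy2 Y0 Y1]] := common_sign y0 y1 ltac:(lra).
exists sx, sy.
have Pn : P n = scale2 sx sy (P 0) by rewrite [LHS]surjective_pairing X0 Y0.
have [t0 v2 PE _ _] := orbit 0; have [t0' v2' PE' _ _] := orbit n.
move: X1 Y1; rewrite PE PE' /= X0 Y0 => X1 Y1.
have {}X1 : t n * (v n).1 = t 0 * (sx * (v 0).1) by lra.
have {}Y1 : t n * (v n).2 = t 0 * (sy * (v 0).2) by lra.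
have tE : t n = t 0.
  apply/eqP; rewrite -(@eqrXn2 _ 2) ?(ltW t0) ?(ltW t0') //; apply/eqP.
  transitivity ((t n * (v n).1) ^+ 2 + (t n * (v n).2) ^+ 2).
    by rewrite !exprMn -mulrDr v2' mulr1.
  by rewrite X1 Y1 !exprMn sx2 sy2 !mul1r -mulrDr v2 mulr1.
split=> //; rewrite tE in X1 Y1; rewrite [LHS]surjective_pairing /scale2.
by rewrite (mulfI (lt0r_neq0 t0) X1) (mulfI (lt0r_neq0 t0) Y1).
Qed.

Lemma symmetric_elliptic_periodic n sx sy : lam < a -> has_caustic a b lam P ->
  sx ^+ 2 = 1 -> sy ^+ 2 = 1 -> (forall k, P (k + n)%N = scale2 sx sy (P k)) ->
  elliptic_periodic a b n P.
Proof.
move=> lam_lt_a tangent sx2 sy2 sym k s _; apply: same_elliptic_coordinates_of_sqr => //.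
- exact: (line_tangent_off_foci lam_lt_a lam_neq_b (tangent (k + n)%N)).
- rewrite /moving_point /= -addSn !sym /=.
  rewrite -[RHS]mul1r -sx2; ring.
rewrite /moving_point /= -addSn !sym /=.
by rewrite -[RHS]mul1r -sy2; ring.
Qed.

(** A coordinate both preserved and negated vanishes together with its velocity, which puts the
    trajectory on an axis. *)
Lemma symmetric_not_periodic n sx sy : (sx = -1 \/ sy = -1) ->
  P n = scale2 sx sy (P 0) -> v n = scale2 sx sy (v 0) -> ~ periodic n P.
Proof.
move=> sE Pn vn per.
have P0 := per 0%N; have P1 := per 1%N; rewrite add0n in P0.
have [t0 _ PE _ _] := orbit 0; have [t0' _ PE' _ _] := orbit n.
have [tu _ _ _ _] := billiard_lax_orbit 0.
have [tu' _ _ _ _] := billiard_lax_orbit n.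
rewrite add1n PE' PE P0 in P1.
have /= ex := congr1 fst P1; have /= ey := congr1 snd P1.
have /= ex0 := congr1 fst Pn; have /= ey0 := congr1 snd Pn.
have /= ex1 := congr1 fst vn; have /= ey1 := congr1 snd vn.
rewrite P0 in ex0 ey0; rewrite ex1 in ex; rewrite ey1 in ey.
have neg (s x y : R) : s = -1 -> x = s * x -> x + t n * (s * y) = x + t 0 * y -> (x, y) = (0, 0).
  move=> -> e1 e2; have x0 : x = 0 by lra.
  have : (t n + t 0) * y = 0 by lra.
  by move/eqP; rewrite mulf_eq0 gt_eqF ?addr_gt0 //= => /eqP y0; rewrite x0 y0.
case: sE => sE.
  exact: (@off_ordinate 0) (neg _ _ _ sE ex0 ex).
exact: (@off_abscissa 0) (neg _ _ _ sE ey0 ey).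
Qed.

(** The splitting is reversed by S = 1 + 2 eps F1 p^2 = -1 + 2 eps F2 q^2, with Q proportional to p
    q. S is 1 at 0 and -1 at the roots of F2, one of which is 1/a or 1/b. *)
Lemma closing_of_pell_factors n eps (rs1 rs2 : seq R) (p q : {poly R}) :
  (2 <= n)%N -> eps ^+ 2 = 1 ->
  (\prod_(r <- rs1) ('X - r%:P)) * (\prod_(r <- rs2) ('X - r%:P)) =
    \prod_(r <- [:: 0; 1 / a; 1 / b; 1 / lam]) ('X - r%:P) ->
  0 \in rs1 -> (1 / a \in rs2) || (1 / b \in rs2) ->
  ((size p).*2 + size rs1 = n.+2)%N -> (size p + size q = n)%N -> p != 0 ->
  (\prod_(r <- rs1) ('X - r%:P)) * p ^+ 2 - (\prod_(r <- rs2) ('X - r%:P)) * q ^+ 2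
    = (- eps)%:P ->
  lam < a -> has_caustic a b lam P -> elliptic_periodic a b n P /\ ~ periodic n P.
Proof.
move=> n2 eps2 prodE r0 rab sp sq p0 eq lam_lt_a tangent.
case: n n2 sp sq => [|[|m]] // _ sp sq.
set F1 := \prod_(r <- rs1) _ in prodE eq; set F2 := \prod_(r <- rs2) _ in prodE eq.
pose S := (2 * eps) *: (F1 * p ^+ 2) + 1%:P.
pose Q := (2 / Num.sqrt (a * b * lam)) *: (p * q).
have k0 : 0 < a * b * lam by rewrite !mulr_gt0.
have eps0 : eps != 0 by rewrite -sqrf_eq0 eps2 oner_eq0.
have e0 : 2 * eps != 0 by rewrite mulf_neq0 ?pnatr_eq0.
have sF1 : size (F1 * p ^+ 2) = m.+3.
  by apply/eqP; rewrite -eqSS size_prod_square // sp.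
have sS : size S = m.+3.
  by rewrite size_polyDl size_scale ?sF1 // (leq_ltn_trans (size_polyC_leq1 _)).
have epsP : eps%:P ^+ 2 = 1 :> {poly R} by rewrite -polyC_exp eps2.
have SE : S = (2 * eps) *: (F2 * q ^+ 2) - 1.
  have -> : F2 * q ^+ 2 = F1 * p ^+ 2 + eps%:P by rewrite -[eps]opprK polyCN -eq; ring.
  rewrite /S -!mul_polyC mulrDr polyCM.
  transitivity (2%:P * eps%:P * (F1 * p ^+ 2) + 2 * eps%:P ^+ 2 - 1); last by ring.
  by rewrite epsP; ring.
have sQ : (size Q <= m.+1)%N.
  rewrite (leq_trans (size_scale_leq _ _)) // (leq_trans (size_polyMleq _ _)) //.
  by rewrite sq.
have S0 : S.[0] = 1.
  have /eqP F10 : root F1 0 by rewrite root_prod_XsubC.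
  by rewrite hornerD hornerZ hornerM F10 mul0r mulr0 add0r hornerC.
have pell : S ^+ 2 - 1 = (a * b * lam) *:
    (\prod_(r <- [:: 0; 1 / a; 1 / b; 1 / lam]) ('X - r%:P)) * Q ^+ 2.
  rewrite -prodE exprZn -scalerAl -scalerAr scalerA expr_div_n sqr_sqrtr ?(ltW k0) //.
  have -> : a * b * lam * (2 ^+ 2 / (a * b * lam)) = 4 * eps ^+ 2.
    by rewrite eps2; field; rewrite !gt_eqF.
  transitivity ((S - 1) * (S + 1)); first by ring.
  rewrite {1}/S SE addrK subrK -!mul_polyC; ring.
have [Pn vn] := symmetric_of_pell sS sQ S0 pell.
have Sa2 : S.[1 / a] ^+ 2 = 1 by apply: (pell_sqr_at_root pell); rewrite !inE eqxx ?orbT.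
have Sb2 : S.[1 / b] ^+ 2 = 1 by apply: (pell_sqr_at_root pell); rewrite !inE eqxx ?orbT.
have sym := symmetric_shift Sa2 Sb2 Pn vn.
split.
  by apply: (symmetric_elliptic_periodic lam_lt_a tangent Sa2 Sb2) => k; have [] := sym k.
have Sm1 r : r \in rs2 -> S.[r] = -1.
  rewrite -root_prod_XsubC => /eqP rz.
  by rewrite SE hornerD hornerZ hornerM rz mul0r mulr0 add0r hornerN hornerC.
apply: symmetric_not_periodic Pn vn.
by case/orP: rab => /Sm1; [left | right].
Qed.

End Invariants.

End Billiard.

(** * Admissible distributions of the roots *)

Lemma pell_factor_difference (R : realFieldType) (eps : R) (S A B : {poly R}) :
  eps ^+ 2 = 1 -> S - 1 = (eps * 2) *: A -> S + 1 = (eps * 2) *: B ->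
  A - B = (- eps)%:P.
Proof.
move=> eps2 SA SB; have eps0 : eps != 0 by rewrite -sqrf_eq0 eps2 oner_eq0.
apply: (@scalerI _ _ (eps * 2)); first by rewrite mulf_neq0 ?pnatr_eq0.
rewrite scalerBr -SA -SB -mul_polyC -polyCM mulrN mulrAC -expr2 eps2 mul1r polyCN.
by ring.
Qed.

(** The signs would force both S(s) >= 1 and S(s) <= -1. *)
Lemma pell_sign_clash (R : realFieldType) (eps s : R) (S A B p q : {poly R}) :
  S - 1 = (eps * 2) *: (A * p ^+ 2) -> S + 1 = (eps * 2) *: (B * q ^+ 2) ->
  0 <= eps * A.[s] -> eps * B.[s] <= 0 -> False.
Proof.
move=> /(congr1 (horner^~ s)) /= SA /(congr1 (horner^~ s)) /= SB A0 B0.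
move: SA SB; rewrite !(hornerD, hornerZ, hornerN, hornerM, hornerC) => SA SB.
have := mulr_ge0 A0 (sqr_ge0 p.[s]); have := mulr_le0_ge0 B0 (sqr_ge0 q.[s]).
rewrite !expr2; lra.
Qed.

(** The midpoint of 1/b and 1/lam lies above 1/a. *)
Lemma separating_point (R : realFieldType) (a b lam : R) :
  0 < b -> b < a -> 0 < lam -> lam < a ->
  exists s, [/\ 0 <= s, 0 <= s - a^-1,
    lam < b -> 0 <= s - b^-1 /\ s - lam^-1 <= 0 &
    b < lam -> s - b^-1 <= 0 /\ 0 <= s - lam^-1].
Proof.
move=> b0 ba l0 la; have a0 := lt_trans b0 ba.
have al0 : 0 < a^-1 by rewrite invr_gt0.
have al_be : a^-1 < b^-1 by rewrite ltf_pV2.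
have al_la : a^-1 < lam^-1 by rewrite ltf_pV2.
have be_la : lam < b -> b^-1 < lam^-1 by move=> h; rewrite ltf_pV2.
have la_be : b < lam -> lam^-1 < b^-1 by move=> h; rewrite ltf_pV2.
exists ((b^-1 + lam^-1) / 2); split.
- lra.
- lra.
- by move/be_la; lra.
- by move/la_be; lra.
Qed.

Lemma sign_of_degree (R : pzRingType) (k j n : nat) :
  (k.*2 + j = n.+3)%N -> (-1) ^+ n.+1 = (-1) ^+ j :> R.
Proof.
move=> /(congr1 odd); rewrite oddD odd_double /= => oj.
by rewrite -signr_odd -[RHS]signr_odd oj /= !negbK.
Qed.

Lemma even_degrees (k l n : nat) : (k.*2 + 2 = n.+3)%N -> (l.*2 + 2 = n.+3)%N ->
  [/\ n.+1 = (2 * k)%N, k = (k - 1).+1 & l = (k - 1).+1].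
Proof. by move=> ? ?; split; lia. Qed.

(** The bound on n makes l positive, so the truncated l - 1 is a true degree. *)
Lemma odd_degrees (k l n : nat) : (2 <= n.+1)%N ->
  (k.*2 + 1 = n.+3)%N -> (l.*2 + 3 = n.+3)%N ->
  [/\ n.+1 = (2 * l + 1)%N, k = l.+1 & l = (l - 1).+1].
Proof. by move=> ? ? ?; split; lia. Qed.

Lemma even_sizes (m n : nat) : (2 <= n)%N -> n = (2 * m)%N ->
  ((m - 1).+1.*2 + 2 = n.+2)%N /\ ((m - 1).+1 + (m - 1).+1 = n)%N.
Proof. by move=> ? ?; split; lia. Qed.

Lemma odd_sizes (m n : nat) : (2 <= n)%N -> n = (2 * m + 1)%N ->
  [/\ (m.+1.*2 + 1 = n.+2)%N, ((m - 1).+1.*2 + 3 = n.+2)%N & (m.+1 + (m - 1).+1 = n)%N].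
Proof. by move=> ? ?; split; lia. Qed.

Theorem theorem3p3 (R : realType) (a b lam0 : R) (n : nat) (P : nat -> R * R)
  (b_gt0 : 0 < b) (b_lt_a : b < a)
  (lam0_range : (0 < lam0 /\ lam0 < b) \/ (b < lam0 /\ lam0 < a))
  (n_ge2 : (2 <= n)%N)
  (trajP : billiard_trajectory a b P) (causticP : has_caustic a b lam0 P) :
  (elliptic_periodic a b n P /\ ~ periodic n P) <->
  exists p q : {poly R},
  [\/ (* (a) *)
      conic_is_ellipse b lam0 /\
      exists m : nat,
        [/\ n = (2 * m)%N, has_degree p (m - 1), has_degree q (m - 1) &
            'X * ('X - (1 / lam0)%:P) * p ^+ 2
            - ('X - (1 / a)%:P) * ('X - (1 / b)%:P) * q ^+ 2 = -1]
        \/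
        [/\ n = (2 * m + 1)%N, has_degree p m, has_degree q (m - 1) &
            'X * p ^+ 2
            - ('X - (1 / a)%:P) * ('X - (1 / b)%:P) * ('X - (1 / lam0)%:P)
              * q ^+ 2 = 1],
      (* (b) *)
      conic_is_hyperbola a b lam0 /\
      exists m : nat,
        [/\ n = (2 * m)%N, has_degree p (m - 1), has_degree q (m - 1) &
            'X * ('X - (1 / b)%:P) * p ^+ 2
            - ('X - (1 / a)%:P) * ('X - (1 / lam0)%:P) * q ^+ 2 = -1]
        \/
        [/\ n = (2 * m + 1)%N, has_degree p m, has_degree q (m - 1) &
            'X * p ^+ 2
            - ('X - (1 / a)%:P) * ('X - (1 / b)%:P) * ('X - (1 / lam0)%:P)
              * q ^+ 2 = 1]
    | (* (c) *)
      conic_is_hyperbola a b lam0 /\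
      exists m : nat,
        [/\ n = (2 * m + 1)%N, has_degree p m, has_degree q (m - 1) &
            ('X - (1 / b)%:P) * p ^+ 2
            - 'X * ('X - (1 / a)%:P) * ('X - (1 / lam0)%:P) * q ^+ 2 = -1]].
Proof.
have a_gt0 := lt_trans b_gt0 b_lt_a.
have lam_gt0 : 0 < lam0 by case: lam0_range => -[]; lra.
have lam_lt_a : lam0 < a by case: lam0_range => -[]; lra.
have lam_neq_a : lam0 != a by rewrite lt_eqF.
have lam_neq_b : lam0 != b by apply/eqP; case: lam0_range => -[]; lra.
have boundary k := on_boundary b_gt0 b_lt_a (let: And3 h _ _ := trajP in h k).
have [v [t [c orbit]]] := billiard_unit_speed b_gt0 b_lt_a trajP.
have caustic k : a * (v k).2 ^+ 2 + b * (v k).1 ^+ 2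
    - ((P k).1 * (v k).2 - (P k).2 * (v k).1) ^+ 2 = lam0.
  have [t0 v2 PE _ _] := orbit k.
  by apply: (caustic_direction lam_lt_a lam_neq_b t0 v2); rewrite -PE; apply: causticP.
split=> [[ell nper] | [p [q cases]]].
  have [sx [sy [sx2 sy2 Pn vn]]] := elliptic_periodic_symmetric b_lt_a orbit ell.
  have [|S [Q [sS S0 Slead pell [Sa Sb]]]] := pell_of_symmetric b_gt0 b_lt_a lam_gt0
    lam_neq_a lam_neq_b boundary orbit caustic _ sx2 sy2 Pn vn; first exact: ltnW.
  have nontriv : ~ (sx = 1 /\ sy = 1).
    move=> [sx1 sy1]; apply: nper => k.
    have [-> _] := symmetric_shift b_gt0 b_lt_a lam_gt0 boundary orbit caustic sx2 sy2 Pn vn k.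
    by rewrite /scale2 sx1 sy1 !mul1r -surjective_pairing.
  have branch_uniq := lax_branch_uniq b_gt0 b_lt_a lam_gt0 lam_neq_a lam_neq_b.
  have Sl2 : S.[1 / lam0] ^+ 2 = 1.
    by apply: (pell_sqr_at_root pell); rewrite !inE eqxx !orbT.
  case: n n_ge2 sS Slead {ell nper Pn vn} => [|n] // n_ge2 sS Slead.
  have kappa0 : 0 <= a * b * lam0 by rewrite !mulr_ge0 // ltW.
  have [p [q [pE qE sp sq]]] := pell_split branch_uniq sS Slead kappa0 pell.
  have eps2 : ((-1) ^+ n.+1) ^+ 2 = 1 :> R by rewrite sqrr_sign.
  have n11 : (-1 == 1 :> R) = false by apply/eqP; lra.
  have n1m : (1 == -1 :> R) = false by apply/eqP; lra.
  have [s [s0 s_al s_ell s_hyp]] : exists s, [/\ 0 <= s, 0 <= s - a^-1,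
      lam0 < b -> 0 <= s - b^-1 /\ s - lam0^-1 <= 0 &
      b < lam0 -> s - b^-1 <= 0 /\ 0 <= s - lam0^-1].
    exact: separating_point.
  have between : (s - b^-1) * (s - lam0^-1) <= 0.
    case: (ltrgtP lam0 b) lam_neq_b => // [/s_ell | /s_hyp] [? ?] _.
      by rewrite mulr_ge0_le0.
    by rewrite mulr_le0_ge0.
  pose hornE := (hornerM, hornerD, hornerN, hornerX, hornerC).
  have diff := pell_factor_difference eps2 pE qE.
  (* Eight cases: the signs of S at 1/a, 1/b, 1/lam0, with 1 before -1. A root with sign 1 goes to
     the factor of p, like 0, the others to that of q. *)
  move: sx2 sy2 Sl2 => /eqP; rewrite sqrf_eq1 => /orP[] /eqP sxE /eqP;
    rewrite sqrf_eq1 => /orP[] /eqP syE /eqP; rewrite sqrf_eq1 => /orP[] /eqP Sl;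
    rewrite sxE in Sa; rewrite syE in Sb;
    move: pE qE sp sq diff; rewrite !big_cons !big_nil /= S0 Sa Sb Sl !eqxx ?n11 ?n1m /=
      ?mulr1 ?subr0 => pE qE sp sq diff.
  - by case: nontriv.
  - by case: nontriv.
  (* Signs (1, -1, 1): case (c), in which p and q trade names. *)
  - have e1 : (-1) ^+ n.+1 = -1 :> R by rewrite (@sign_of_degree _ _ 1 _ sq).
    have [n_odd sq' sp'] := @odd_degrees _ _ _ n_ge2 sq sp.
    case: lam0_range => [[_ lb] | [bl lt_a]].
      have [? ?] := s_ell lb; exfalso; apply: (pell_sign_clash (s := s) pE qE); rewrite e1 !hornE !div1r ?mul1r ?mulN1r ?oppr_ge0 ?oppr_le0 //.
      by apply: mulr_ge0_le0 => //; apply: mulr_ge0_le0.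
    exists q, p; apply: Or33; split; first by split.
    exists (size p); split=> //; move: diff; rewrite e1 opprK => diff.
    by rewrite -[RHS]/(- 1%:P) -diff; ring.
  (* Signs (1, -1, -1): excluded for both kinds of caustic, as is (-1, 1, 1) next. *)
  - have e1 : (-1) ^+ n.+1 = 1 :> R by rewrite (@sign_of_degree _ _ 2 _ sp) -signr_odd.
    have [n_even sp' sq'] := @even_degrees _ _ _ sp sq.
    exfalso; apply: (pell_sign_clash (s := s) pE qE); rewrite e1 !hornE !div1r ?mul1r ?mulN1r ?oppr_ge0 ?oppr_le0 //.
    by rewrite mulr_ge0.
  - have e1 : (-1) ^+ n.+1 = -1 :> R by rewrite (@sign_of_degree _ _ 1 _ sq).
    have [n_odd sq' sp'] := @odd_degrees _ _ _ n_ge2 sq sp.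
    exfalso; apply: (pell_sign_clash (s := s) pE qE); rewrite e1 !hornE !div1r ?mul1r ?mulN1r ?oppr_ge0 ?oppr_le0 //.
    by rewrite mulr_ge0_le0.
  (* Signs (-1, 1, -1): the even hyperbolic case. *)
  - have e1 : (-1) ^+ n.+1 = 1 :> R by rewrite (@sign_of_degree _ _ 2 _ sp) -signr_odd.
    have [n_even sp' sq'] := @even_degrees _ _ _ sp sq.
    case: lam0_range => [[_ lb] | [bl lt_a]].
      have [? ?] := s_ell lb; exfalso; apply: (pell_sign_clash (s := s) pE qE); rewrite e1 !hornE !div1r ?mul1r ?mulN1r ?oppr_ge0 ?oppr_le0.
        by rewrite mulr_ge0.
      by rewrite mulr_ge0_le0.
    exists p, q; apply: Or32; split; first by split.
    by exists (size p); left; split=> //; move: diff; rewrite e1 polyCN.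
  (* Signs (-1, -1, 1): the even elliptic case. *)
  - have e1 : (-1) ^+ n.+1 = 1 :> R by rewrite (@sign_of_degree _ _ 2 _ sp) -signr_odd.
    have [n_even sp' sq'] := @even_degrees _ _ _ sp sq.
    case: lam0_range => [[_ lb] | [bl lt_a]]; last first.
      have [? ?] := s_hyp bl; exfalso; apply: (pell_sign_clash (s := s) pE qE); rewrite e1 !hornE !div1r ?mul1r ?mulN1r ?oppr_ge0 ?oppr_le0.
        by rewrite mulr_ge0.
      by rewrite mulr_ge0_le0.
    exists p, q; apply: Or31; split; first by [].
    by exists (size p); left; split=> //; move: diff; rewrite e1 polyCN.
  (* All signs -1: the odd equation shared by (a) and (b). *)
  - have e1 : (-1) ^+ n.+1 = -1 :> R by rewrite (@sign_of_degree _ _ 1 _ sp).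
    have [n_odd sp' sq'] := @odd_degrees _ _ _ n_ge2 sp sq.
    exists p, q; case: lam0_range => [[_ lb] | [bl lt_a]]; [apply: Or31 | apply: Or32];
      (split; first by []); exists (size q); right; split=> //;
      by move: diff; rewrite e1 opprK mulrA.
pose close := closing_of_pell_factors b_gt0 b_lt_a lam_gt0 lam_neq_a lam_neq_b boundary orbit caustic.
have size_neq0 (r : {poly R}) d : size r = d.+1 -> r != 0.
  by move=> sr; rewrite -size_poly_eq0 sr.
have one2 : 1 ^+ 2 = 1 :> R by rewrite expr1n.
have opp2 : (-1) ^+ 2 = 1 :> R by rewrite sqrrN expr1n.
have in2l (x y : R) : x \in [:: x; y] by rewrite inE eqxx.
case: cases => [[_ [m [[nE dp dq eq] | [nE dp dq eq]]]] |
                [_ [m [[nE dp dq eq] | [nE dp dq eq]]]] | [_ [m [nE dp dq eq]]]].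
- have [e1 e2] := even_sizes n_ge2 nE.
  apply: (close n 1 [:: 0; 1 / lam0] [:: 1 / a; 1 / b] p q) => //; rewrite ?dp ?dq ?in2l //.
  + by rewrite !big_cons !big_nil; ring.
  + exact: size_neq0 dp.
  by rewrite polyCN polyC1 -eq !big_cons !big_nil; ring.
- have [e1 _ e2] := odd_sizes n_ge2 nE.
  apply: (close n (-1) [:: 0] [:: 1 / a; 1 / b; 1 / lam0] p q) => //;
    rewrite ?dp ?dq ?mem_head //.
  + by rewrite !big_cons !big_nil; ring.
  + exact: size_neq0 dp.
  by rewrite opprK polyC1 -[RHS]eq !big_cons !big_nil; ring.
- have [e1 e2] := even_sizes n_ge2 nE.
  apply: (close n 1 [:: 0; 1 / b] [:: 1 / a; 1 / lam0] p q) => //; rewrite ?dp ?dq ?in2l //.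
  + by rewrite !big_cons !big_nil; ring.
  + exact: size_neq0 dp.
  by rewrite polyCN polyC1 -eq !big_cons !big_nil; ring.
- have [e1 _ e2] := odd_sizes n_ge2 nE.
  apply: (close n (-1) [:: 0] [:: 1 / a; 1 / b; 1 / lam0] p q) => //;
    rewrite ?dp ?dq ?mem_head //.
  + by rewrite !big_cons !big_nil; ring.
  + exact: size_neq0 dp.
  by rewrite opprK polyC1 -[RHS]eq !big_cons !big_nil; ring.
have [_ e1 e2] := odd_sizes n_ge2 nE.
(* The equation of (c) is negated and p, q are exchanged, so that 0 is a root of the first
   product. *)
apply: (close n (-1) [:: 0; 1 / a; 1 / lam0] [:: 1 / b] q p) => //;
  rewrite ?dp ?dq ?mem_head ?orbT //.
+ by rewrite !big_cons !big_nil; ring.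
+ by rewrite addnC.
+ exact: size_neq0 dq.
rewrite opprK polyC1 -[RHS]opprK -eq !big_cons !big_nil; ring.
Qed.
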